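(* There is an algorithm that, given a 2-connected graph $G$ with $n$ nodes and $m$ edges that has no $K_2$-cutset, outputs YES if $G\in\mathcal C_2$ and NO otherwise, in time $\mathcal O(n^2m^2)$.
   Context: All graphs are finite, simple and undirected. A propeller $(C,x)$ is a graph consisting of a chordless cycle $C$ (the rim) and a node $x\notin V(C)$ (the center) that has at least two neighbors on $C$. $\mathcal C_2$ is the class of graphs that do not contain a propeller as an induced subgraph. A graph is 2-connected if removing fewer than 2 nodes never leaves a disconnected graph or a single node. A $K_2$-cutset is a set $\{a,b\}$ with $ab\in E(G)$ such that $G\setminus\{a,b\}$ is disconnected. *)

(* Defs.v *)
From HB Require Import structures.
From mathcomp Require Import all_boot.

Set Implicit Arguments.
Unset Strict Implicit.
Unset Printing Implicit Defensive.

Record sgraph := SGraph {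
  vertex :> finType;
  edge : rel vertex;
  edge_sym : symmetric edge;
  edge_irrefl : irreflexive edge }.

Definition edges (G : sgraph) : {set {set G}} :=
  [set [set p.1; p.2] | p : G * G & edge p.1 p.2].

Section Induced.
Variables (G : sgraph) (S : {set G}).

Definition induced_edge : rel {x : G | x \in S} :=
  fun x y => edge (val x) (val y).

Lemma induced_sym : symmetric induced_edge.
Proof. by move=> x y; apply: edge_sym. Qed.

Lemma induced_irrefl : irreflexive induced_edge.
Proof. by move=> x; apply: edge_irrefl. Qed.

Definition induced : sgraph := SGraph induced_sym induced_irrefl.
End Induced.

Definition remove (G : sgraph) (S : {set G}) : sgraph := induced (~: S).

(* With this definition the graph without nodes is not disconnected. *)
Definition disconnected (G : sgraph) : Prop :=
  exists x y : G, ~~ connect (@edge G) x y.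

Definition two_connected (G : sgraph) : Prop :=
  forall S : {set G}, #|S| < 2 ->
    ~ disconnected (remove S) /\ #|remove S| <> 1.

Definition K2_cutset (G : sgraph) (a b : G) : Prop :=
  edge a b /\ disconnected (remove [set a; b]).

(* Triangles are allowed. *)
Definition chordless_cycle (G : sgraph) (c : seq G) : Prop :=
  [/\ 3 <= size c, ucycle (@edge G) c
    & forall x y, x \in c -> y \in c -> edge x y ->
        y = next c x \/ x = next c y].

(* The whole graph G is a propeller with rim c and center x. *)
Definition propeller (G : sgraph) : Prop :=
  exists (c : seq G) (x : G),
    [/\ chordless_cycle c, x \notin c,
        2 <= #|[set y in c | edge x y]|
      & forall z : G, z \in x :: c].

Definition in_C2 (G : sgraph) : Prop :=
  forall S : {set G}, ~ propeller (induced S).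

(* The model of computation is the unit-cost random access machine: registers
   and memory cells hold natural numbers, memory is accessed by indirect
   addressing, and the only arithmetic is addition and truncated subtraction
   (unit-cost multiplication would make the model unrealistically strong).
   Programs are structured instead of using jumps; the cost of an expression
   is its number of operations, so that one unit of time is one elementary
   machine step up to a constant factor. *)
Inductive expr :=
  | Cst of nat
  | Reg of nat
  | Read of expr
  | Add of expr & expr
  | Sub of expr & expr.

Inductive prog :=
  | Skip
  | Assign of nat & expr
  | Write of expr & expr
  | Seq of prog & prog
  | If of expr & prog & prog
  | While of expr & prog.

Record state := State { reg : nat -> nat; mem : nat -> nat }.

Definition upd (f : nat -> nat) (a v : nat) : nat -> nat :=
  fun b => if b == a then v else f b.

Fixpoint eval (s : state) (e : expr) : nat :=
  match e with
  | Cst k => k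
  | Reg r => reg s r
  | Read e => mem s (eval s e)
  | Add e1 e2 => eval s e1 + eval s e2
  | Sub e1 e2 => eval s e1 - eval s e2
  end.

Fixpoint cost (e : expr) : nat :=
  match e with
  | Cst _ | Reg _ => 1
  | Read e => (cost e).+1
  | Add e1 e2 | Sub e1 e2 => (cost e1 + cost e2).+1
  end.

(* exec p s s' t: started in state s, the program p halts in state s' after
   time t. In tests, a value is true when it is nonzero. *)
Inductive exec : prog -> state -> state -> nat -> Prop :=
  | ExecSkip s : exec Skip s s 1
  | ExecAssign s r e :
      exec (Assign r e) s (State (upd (reg s) r (eval s e)) (mem s))
           (cost e).+1
  | ExecWrite s e1 e2 :
      exec (Write e1 e2) s
           (State (reg s) (upd (mem s) (eval s e1) (eval s e2)))
           (cost e1 + cost e2).+1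
  | ExecSeq p1 p2 s s1 s2 t1 t2 :
      exec p1 s s1 t1 -> exec p2 s1 s2 t2 ->
      exec (Seq p1 p2) s s2 (t1 + t2)
  | ExecIfTrue e p1 p2 s s' t :
      eval s e != 0 -> exec p1 s s' t ->
      exec (If e p1 p2) s s' (cost e + t).+1
  | ExecIfFalse e p1 p2 s s' t :
      eval s e == 0 -> exec p2 s s' t ->
      exec (If e p1 p2) s s' (cost e + t).+1
  | ExecWhileTrue e p s s1 s2 t1 t2 :
      eval s e != 0 -> exec p s s1 t1 -> exec (While e p) s1 s2 t2 ->
      exec (While e p) s s2 (cost e + t1 + t2).+1
  | ExecWhileFalse e p s :
      eval s e == 0 -> exec (While e p) s s (cost e).+1.

(* Hence "some execution halts within time t with output o" says that the
   execution does. *)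
Lemma exec_det p s s1 s2 t1 t2 :
  exec p s s1 t1 -> exec p s s2 t2 -> s1 = s2 /\ t1 = t2.
Proof.
move=> H; elim: H s2 t2 => {p s s1 t1}; intros;
  repeat match goal with
  | H : is_true (?x != 0), H' : is_true (?x == 0) |- _ => by rewrite H' in H
  | IH : (forall s2 t2, exec ?p ?s s2 t2 -> _ /\ _), H : exec ?p ?s _ _ |- _ =>
      case: (IH _ _ H) => ? ?; subst; clear H
  | H : exec _ _ ?s2 ?t2 |- _ = ?s2 /\ _ = ?t2 => inversion H; subst; clear H
  end; by [].
Qed.

(* The number of nodes followed by the rows of the adjacency matrix. *)
Definition encode (G : sgraph) : seq nat :=
  #|G| :: [seq nat_of_bool (edge x y) | x <- enum G, y <- enum G].

Definition init (G : sgraph) : state :=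
  State (fun=> 0) (fun a => nth 0 (encode G) a).

Definition NO : nat := 0.
Definition YES : nat := 1.
Definition output (s : state) : nat := reg s 0.

(* Main.v *)
Require Import Defs.
From mathcomp Require Import all_boot zify.

(* Let G be 2-connected without K2-cutset and with at least four nodes. Then G
   has no propeller iff, for every x, any two neighbors y, z of x are separated
   in G \ x by a clique with at most two nodes, neither of them y or z. This is
   tested by a graph search, in time O(n^2), for each of the 2m arcs (x, y) and
   each of the O(m) cliques.

   A clique cannot separate two nodes of a chordless cycle, so separation
   excludes propellers. Conversely suppose there is no propeller. Adjacent y, z
   would give a triangle xyz, and a component of the rest of G would see all of
   it, which gives a propeller. For nonadjacent y, z let U consist of y and the
   nodes that share a chordless cycle of G \ x with y; it misses z. Let D be the
   component of z in G \ x \ U. If y sees D, its only neighbor in D separates.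
   Otherwise N(D) separates; it has at most two nodes if it is a clique. If it
   contains nonadjacent u, v, take chordless cycles C_u and C_v through y and u,
   respectively v: rerouting C_u or C_v through D, which would put a node of D
   into U, or a short case analysis then yields a propeller. *)

Set Implicit Arguments.
Unset Strict Implicit.
Unset Printing Implicit Defensive.

(** Whether two given nodes lie on a common chordless cycle is NP-complete to decide in general, so
    propellers with center x are not searched for directly. The criterion replaces this question by
    reachability after the deletion of x and a clique. The separating clique may vary with z, so
    every clique is tried for each arc, and one search from y serves all z at once. Cycles are
    mostly handled opened at a node, as [hole y p]: the arguments cut, reverse or reroute the path p
    while y stays in place. Since every node of G has a neighbor, n <= 2m, which lets the bound
    absorb the cliques with fewer than two nodes and all terms of lower order. The machine cannot
    multiply, so rows of the matrix are reached by repeated addition. *)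

Local Notation wedge W := [rel a b | [&& edge a b, W a & W b]].

(** * Chordless paths and cycles *)

Lemma split_last (T : Type) (a : pred T) (s : seq T) : has a s ->
  exists s1 w s2, [/\ s = s1 ++ w :: s2, a w & ~~ has a s2].
Proof.
elim: s => //= x s IH.
have [/IH[s1 [w [s2 [-> aw h2]]]] _|hs] := boolP (has a s).
  by exists (x :: s1), w, s2.
by rewrite orbF => ax; exists [::], x, s.
Qed.

Lemma split_first (T : Type) (a : pred T) (s : seq T) : has a s ->
  exists s1 w s2, [/\ s = s1 ++ w :: s2, a w & ~~ has a s1].
Proof.
elim: s => //= x s IH.
case ax: (a x); first by exists [::], x, s.
case/IH=> s1 [w [s2 [-> aw h1]]].
by exists (x :: s1), w, s2; split=> //=; rewrite ax.
Qed.

Section Holes.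
Variable G : sgraph.
Implicit Types (x y z u v w : G) (p q s c : seq G) (W : pred G).

(** The nodes of a chordless path in order: each is adjacent to its successor and to no later node.
    The default of [head] is never met, because [all] then ranges over the empty list. *)
Fixpoint ipath s : bool :=
  if s is x :: s' then
    [&& x \notin s', all (fun z => edge x z == (z == head x s')) s' & ipath s']
  else true.

(** The tool for cutting and gluing: the only edge between the two parts joins the last node of [p]
    to the first of [q]. The defaults [b] and [a] do not matter, as both lists are nonempty once [a]
    and [b] are given. *)
Lemma ipath_cat p q :
  ipath (p ++ q) <->
  [/\ ipath p, ipath q & {in p & q, forall a b,
     a != b /\ edge a b = (a == last b p) && (b == head a q)}].
Proof.
elim: p => [|x p IH] /=; first by split=> [|[]].
split.
  case/and3P; rewrite mem_cat negb_or => /andP[xp xq].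
  rewrite all_cat => /andP[/allP Ap /allP Aq] /IH[Ip Iq H]; split=> //.
    rewrite xp Ip andbT; apply/allP=> z zp; rewrite (eqP (Ap z zp)).
    by case: (p) zp.
  move=> a b; rewrite inE => /orP[/eqP-> bq|ap bq].
    split; first by apply: contraNneq xq => ->.
    rewrite (eqP (Aq b bq)); case: (p) xp (H) => [|a' p'] /= xp H'; first by rewrite eqxx.
    have -> : (x == last a' p') = false.
      by apply: contraNF xp => /eqP->; rewrite mem_last.
    by have [/negbTE] := H' a' b (mem_head _ _) bq; rewrite eq_sym.
  have [ab ->] := H a b ap bq; split=> //.
  by case: (p) ap.
case=> /and3P[xp /allP Ap Ip] Iq H.
apply/and3P; split.
- rewrite mem_cat negb_or xp /=; apply/negP=> xq.
  by have [] := H x x (mem_head _ _) xq; rewrite eqxx.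
- rewrite all_cat; apply/andP; split; apply/allP=> z zp.
    by rewrite (eqP (Ap z zp)); case: (p) zp.
  have [_ ->] := H x z (mem_head _ _) zp.
  case: (p) xp (H) => [|a' p'] /= xp H'; first by rewrite eqxx.
  have -> : (x == last a' p') = false.
    by apply: contraNF xp => /eqP->; rewrite mem_last.
  have [|/negbTE + _] := H' a' z _ zp; first by rewrite !inE eqxx orbT.
  by rewrite eq_sym => ->.
- apply/IH; split=> // a b ap bq.
  have [|ab ->] := H a b _ bq; first by rewrite inE ap orbT.
  by split=> //; case: (p) ap.
Qed.

Lemma ipath_uniq s : ipath s -> uniq s.
Proof. by elim: s => //= x s IH /and3P[-> _ /IH]. Qed.

Lemma ipath_rev s : ipath s -> ipath (rev s).
Proof.
elim: s => // x s IH /= /and3P[xs /allP A /IH Is].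
rewrite rev_cons -cats1; apply/ipath_cat; split=> // a b.
rewrite mem_rev !inE => as_ /eqP->; rewrite eqxx andbT edge_sym.
split; first by apply: contraNneq xs => <-.
rewrite (eqP (A a as_)); case: (s) => [|y s'] //=.
by rewrite rev_cons last_rcons.
Qed.

Lemma ipath_path x p : ipath (x :: p) -> path (@edge G) x p.
Proof.
elim: p x => //= y p IH x /and3P[_ /andP[+ _] I].
by rewrite eqxx => /eqP-> /=; apply: IH.
Qed.

(** Shortcuts are taken from the back: a chordless path from the second node of the walk is cut down
    to begin at the last neighbor of [x] on it (or at [x], if [x] occurs on it later), and then [x]
    is put in front. *)
Lemma ipath_of_walk (T : pred G) x p :
  path (@edge G) x p -> T (last x p) ->
  exists q, [/\ ipath (x :: q), T (last x q), {subset q <= p}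
              & forall z, z \in x :: q -> T z -> z = last x q].
Proof.
elim: p x => [|y p IH] x.
  by move=> _ Tx; exists [::]; split=> // z; rewrite inE => /eqP.
rewrite [last _ _]/= => /andP[exy /IH{}IH] /IH[q [Iq Tq sq Uq]].
case Tx: (T x).
  by exists [::]; split=> // z; rewrite inE => /eqP.
have sq' : {subset y :: q <= y :: p}.
  by move=> z; rewrite !inE => /orP[->|/sq->] //; rewrite orbT.
have /split_last[q1 [w [q2 [E aw nq2]]]] :
  has (fun w => (w == x) || edge x w) (y :: q) by rewrite /= exy orbT.
have Lq : last y q = last w q2.
  by rewrite -[LHS]/(last y (y :: q)) E last_cat.
move: Iq; rewrite E => /ipath_cat[_ Iq _].
have s2 : {subset w :: q2 <= y :: q}.
  by move=> z zq; rewrite E mem_cat zq orbT.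
case/orP: aw => [/eqP wx|exw].
  rewrite wx in Lq Iq s2.
  exists q2; rewrite -Lq; split=> // [z zq|z zq]; last by move/Uq; apply; exact: s2.
  by apply/sq'/s2; rewrite inE zq orbT.
have xw : x != w by apply: contraTneq exw => ->; rewrite edge_irrefl.
exists (w :: q2); rewrite [last _ _]/= -Lq; split=> //.
- apply/and3P; split=> //.
    rewrite inE negb_or xw /=; apply: contra nq2 => xq2.
    by apply/hasP; exists x; rewrite ?eqxx.
  rewrite /= exw eqxx /=; apply/allP=> z zq; apply/eqP; apply/idP/eqP => [ez|->//].
  by case/negP: nq2; apply/hasP; exists z; rewrite // ez orbT.
- by move=> z /s2/sq'.
move=> z; rewrite inE => /orP[/eqP->|/s2/Uq//]; by rewrite Tx.
Qed.

Lemma ipath_edge p z w : ipath p -> z \in p -> w \in p -> edge z w ->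
  exists p1 p2, p = p1 ++ z :: w :: p2 \/ p = p1 ++ w :: z :: p2.
Proof.
elim: p => //= x p IH /and3P[xp /allP Ap /IH{}IH].
have H a b : a \in p -> b = x -> edge a b -> exists p2, x :: p = b :: a :: p2.
  move=> ap -> eab; move: (Ap _ ap); rewrite edge_sym eab eq_sym eqb_id => /eqP aE.
  by case: (p) ap aE => // c p' _ /= ->; exists p'.
rewrite !inE => /orP[/eqP zx|zp] /orP[/eqP wx|wp] e.
- by move: e; rewrite zx wx edge_irrefl.
- rewrite edge_sym in e; have [p2 ->] := H _ _ wp zx e.
  by exists [::], p2; left.
- by have [p2 ->] := H _ _ zp wx e; exists [::], p2; right.
have [p1 [p2 [->|->]]] := IH zp wp e; exists (x :: p1), p2; by [left|right].
Qed.

(* A chordless cycle opened at its node [y]. *)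
Definition hole y p :=
  [&& 1 < size p, y \notin p, ipath p
    & all (fun z => edge y z == (z == head y p) || (z == last y p)) p].

Lemma next_mid p1 a b p2 : uniq (p1 ++ a :: b :: p2) ->
  next (p1 ++ a :: b :: p2) a = b.
Proof. by move=> U; rewrite -(next_rot (size p1) U) rot_size_cat /= eqxx. Qed.

Lemma next_end y p a : uniq (y :: rcons p a) -> next (y :: rcons p a) a = y.
Proof.
move=> U; rewrite -(next_rot (size (y :: p)) U) -cats1 -cat_cons rot_size_cat.
by rewrite /= eqxx.
Qed.

Lemma hole_cycle y p : hole y p -> chordless_cycle (y :: p).
Proof.
case/and4P=> sp yp Ip /allP Ay.
have U : uniq (y :: p) by rewrite /= yp ipath_uniq.
have H z w : z = y -> w \in p -> edge z w ->
    w = next (y :: p) z \/ z = next (y :: p) w.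
  move=> -> wp; rewrite (eqP (Ay w wp)) => /orP[] /eqP.
    by case: (p) wp => // x p' _ /= ->; left; rewrite eqxx.
  case/lastP: (p) U wp => // p' x U _; rewrite last_rcons => ->; right.
  by rewrite next_end.
split=> //.
  rewrite /ucycle U andbT; case/lastP: (p) sp Ip Ay yp => // p' x _ Ip Ay yp.
  rewrite /= rcons_path last_rcons edge_sym (eqP (Ay _ _)); last first.
    by rewrite mem_rcons mem_head.
  rewrite last_rcons eqxx orbT andbT.
  case: (p') Ip Ay => [|a p''] Ip Ay.
    by rewrite /= (eqP (Ay _ _)) ?mem_head //= eqxx.
  by apply/andP; split; [rewrite (eqP (Ay _ _)) ?mem_head //= eqxx|exact: ipath_path].
move=> z w; rewrite !(in_cons y) => /orP[/eqP zy|zp] /orP[/eqP wy|wp] e.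
- by move: e; rewrite zy wy edge_irrefl.
- exact: H.
- by rewrite edge_sym in e; case: (H _ _ wy zp e); [right|left].
have [p1 [p2 [E|E]]] := ipath_edge Ip zp wp e; [left|right].
  by move: U; rewrite E -cat_cons => U; rewrite next_mid.
by move: U; rewrite E -cat_cons => U; rewrite next_mid.
Qed.

Lemma cycle_hole c y : chordless_cycle c -> y \in c ->
  exists p, hole y p /\ c =i y :: p.
Proof.
case=> sc; rewrite /ucycle => /andP[Cc Uc] Hc yc.
have [i p E] := rot_to yc.
have memc : c =i y :: p by move=> z; rewrite -E mem_rot.
exists p; split=> //.
have U : uniq (y :: p) by rewrite -E rot_uniq.
have C : cycle (@edge G) (y :: p) by rewrite -E rot_cycle.
have nE : next c =1 next (y :: p) by move=> z; rewrite -E next_rot.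
have {}Hc z w : z \in y :: p -> w \in y :: p -> edge z w ->
    w = next (y :: p) z \/ z = next (y :: p) w.
  by rewrite -!nE -!memc; apply: Hc.
have {sc} : 3 <= size (y :: p) by rewrite -E size_rot.
rewrite /= ltnS => sp; case/andP: (U) => yp Up.
(* The successor of a node of [p] is [y] or lies further along [p]. This excludes chords that point
   backwards. *)
have back a b p1 p2 : p = p1 ++ b :: p2 -> a \in y :: p -> a = next (y :: p) b ->
    a \in y :: p2.
  move=> Ep _ ->; case: p2 Ep => [|d p2] Ep.
    by rewrite Ep cats1 next_end ?mem_head // -cats1 -Ep.
  by rewrite Ep -cat_cons next_mid ?inE ?eqxx ?orbT // cat_cons -Ep.
apply/and4P; split=> //.
- suff H p1 p2 : p = p1 ++ p2 -> ipath p2 by apply: (H [::]).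
  elim: p2 p1 => // x p2 IH p1 Ep /=; rewrite (IH (rcons p1 x)) ?cat_rcons //.
  have : uniq (p1 ++ x :: p2) by rewrite -Ep.
  rewrite cat_uniq /= => /and3P[_ _ /andP[xp2 Up2]].
  have yx : x != y by apply: contraNneq yp => <-; rewrite Ep mem_cat inE eqxx orbT.
  rewrite xp2 andbT; apply/allP=> z zp2; apply/eqP; apply/idP/idP => [e|/eqP->].
    have zp : z \in y :: p by rewrite Ep !(inE, mem_cat) zp2 !orbT.
    have xp : x \in y :: p by rewrite Ep !(inE, mem_cat) eqxx !orbT.
    case: (Hc x z xp zp e) => [|xE].
      case: (p2) zp2 Ep => // b p3 _ Ep ->.
      by rewrite Ep -cat_cons next_mid // cat_cons -Ep.
    case/splitPr: zp2 Ep xp2 => q1 q2 Ep xp2.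
    have := back x z (p1 ++ x :: q1) q2 _ xp xE.
    rewrite -catA cat_cons => /(_ Ep); rewrite inE (negbTE yx) /= => xq.
    by move: xp2; rewrite mem_cat inE xq !orbT.
  move: C; case: (p2) zp2 Ep => // b p3 _ Ep; rewrite Ep /= rcons_cat cat_path /=.
  by case/and4P.
apply/allP=> z zp; apply/eqP; apply/idP/idP => [e|].
  have zyp : z \in y :: p by rewrite inE zp orbT.
  case: (Hc y z (mem_head _ _) zyp e) => [->|yE].
    by case: (p) zp => //= x p' _; rewrite !eqxx.
  case/splitPr: zp yp U yE => q1 q2 yp U yE.
  case: q2 yp U yE => [|d q2] yp U yE; first by rewrite last_cat /= eqxx orbT.
  move: yp; rewrite {1}yE -cat_cons next_mid //.
  by rewrite !(mem_cat, inE) eqxx !orbT.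
case/orP=> /eqP ->.
  by case: (p) sp C => //= a q _ /andP[].
case/lastP: (p) sp C => // q a _; rewrite /= rcons_path last_rcons edge_sym.
by case/andP.
Qed.

(** Stated inside [G], with two explicit neighbors instead of an induced subgraph and a cardinality,
    so that the graph arguments need no transport along [val]. *)
Definition propeller_free :=
  forall c x a b, chordless_cycle c -> x \notin c -> a \in c -> b \in c ->
    a != b -> edge x a -> edge x b -> False.

Definition att W u := [exists q, W q && edge u q].

Lemma attP W u : reflect (exists2 q, W q & edge u q) (att W u).
Proof.
apply: (iffP existsP) => [[q /andP[]]|[q Wq e]]; first by exists q.
by exists q; rewrite Wq.
Qed.

Definition connected W :=
  forall a b, W a -> W b -> exists2 p, path (@edge G) a p & all W p /\ last a p = b.

(* [s] and [t] themselves may be equal or adjacent. *)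
Lemma att_ipath W (s t : G) : connected W -> att W s -> att W t -> ~~ W s ->
  exists (q0 : G) q, [/\ ipath (s :: q0 :: q), all W (q0 :: q)
    & {in q0 :: q, forall z, edge t z = (z == last q0 q)}].
Proof.
move=> cW /attP[a Wa sa] /attP[b Wb tb] nWs.
have [p pp [Wp lp]] := cW _ _ Wa Wb.
have Pw : path (@edge G) s (a :: p) by rewrite /= sa.
have [|[|q0 q] [Iq /andP[Wq eq] sq Uq]] :=
    @ipath_of_walk [pred z | W z && edge t z] _ _ Pw.
- by rewrite /= lp Wb.
- by rewrite /= (negbTE nWs) in Wq.
have aW : all W (q0 :: q).
  by apply/allP=> z /sq; rewrite inE => /orP[/eqP->|/(allP Wp)].
exists q0, q; split=> // z zq; apply/idP/eqP => [e|->//].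
by apply: Uq; rewrite ?inE in zq *; rewrite ?zq ?orbT //= e (allP aW z) ?inE.
Qed.

(** A chordless path from [u] to [v] through [W1] and one back through [W2] close up to a chordless
    cycle, because no edge joins the two sides. Then [r] is a center. *)
Lemma two_sides W1 W2 u v r : propeller_free ->
  connected W1 -> connected W2 ->
  (forall a b, W1 a -> W2 b -> a != b /\ ~~ edge a b) ->
  u != v -> ~~ edge u v -> ~~ W1 u -> ~~ W1 v -> ~~ W2 u -> ~~ W2 v ->
  att W1 u -> att W1 v -> att W2 u -> att W2 v ->
  ~~ W1 r -> ~~ W2 r -> edge r u -> edge r v -> False.
Proof.
move=> PF c1 c2 D12 uv nuv n1u n1v n2u n2v a1u a1v a2u a2v n1r n2r ru rv.
have [p0 [p [Ip Wp Hp]]] := att_ipath c1 a1u a1v n1u.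
have [q0 [q [Iq Wq Hq]]] := att_ipath c2 a2v a2u n2v.
have W1p z : z \in p0 :: p -> W1 z by move/(allP Wp).
have W2q z : z \in q0 :: q -> W2 z by move/(allP Wq).
have H : hole u ((p0 :: p) ++ v :: q0 :: q).
  apply/and4P; split.
  - by rewrite size_cat /= !addnS.
  - rewrite mem_cat (in_cons v) (negbTE uv) /=; apply/norP; split.
      by apply: contra n1u; apply: W1p.
    by apply: contra n2u; apply: W2q.
  - apply/ipath_cat; split=> //; first by case/and3P: Ip.
    move=> a b ap; rewrite in_cons => /predU1P[->|bq].
      rewrite [edge a v]edge_sym Hp // eqxx andbT; split=> //.
      by apply: contraNneq n1v => <-; apply: W1p.
    have [ab /negbTE->] := D12 _ _ (W1p _ ap) (W2q _ bq); split=> //.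
    rewrite /= [b == v](_ : _ = false) ?andbF //.
    by apply: contraNF n2v => /eqP<-; apply: W2q.
  apply/allP=> z; rewrite mem_cat (in_cons v) last_cat => /or3P[zp|/eqP->|zq].
  - case/and3P: Ip => _ /allP/(_ z zp)/eqP-> _ /=.
    rewrite [z == last _ _](_ : _ = false) ?orbF //.
    apply: contraTF (W1p _ zp) => /eqP->; apply/negP=> W1l.
    by have [] := D12 _ _ W1l (W2q _ (mem_last _ _)); rewrite eqxx.
  - rewrite (negbTE nuv) eq_sym eqbF_neg.
    apply/norP; split; first by apply: contraNneq n1v => ->; apply/W1p/mem_head.
    by apply: contraNneq n2v => /= ->; apply: W2q; apply: mem_last.
  rewrite Hq //= [z == p0](_ : _ = false) //.
  apply: contraTF (W2q _ zq) => /eqP->; apply/negP=> W2p.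
  by have [] := D12 _ _ (W1p _ (mem_head _ _)) W2p; rewrite eqxx.
apply: (PF _ r u v (hole_cycle H)) => //.
- rewrite in_cons mem_cat (in_cons v); apply/norP; split.
    by apply: contraTneq ru => ->; rewrite edge_irrefl.
  apply/norP; split; first by apply: contra n1r; apply: W1p.
  apply/norP; split; first by apply: contraTneq rv => ->; rewrite edge_irrefl.
  by apply: contra n2r; apply: W2q.
- exact: mem_head.
- by rewrite !(in_cons, mem_cat) eqxx !orbT.
Qed.

(** The edge [ab] and a chordless path through [W] close up to a chordless cycle, and [r] is a
    center. *)
Lemma no_att_triangle W a b r : propeller_free -> connected W ->
  edge a b -> edge r a -> edge r b -> att W a -> att W b ->
  ~~ W a -> ~~ W b -> ~~ W r -> False.
Proof.
move=> PF cW ab ra rb aa ab' na nb nr.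
have [p0 [p [Ip Wp Hp]]] := att_ipath cW aa ab' na.
have Wp' z : z \in p0 :: p -> W z by move/(allP Wp).
have nab : a != b by apply: contraTneq ab => ->; rewrite edge_irrefl.
have H : hole b (a :: p0 :: p).
  apply/and4P; split=> //.
    by rewrite in_cons eq_sym (negbTE nab) /=; apply: contra nb; apply: Wp'.
  apply/allP=> z; rewrite in_cons => /predU1P[->|zp].
    by rewrite edge_sym ab /= eqxx.
  rewrite Hp //= [z == a](_ : _ = false) //.
  by apply: contraTF (Wp' _ zp) => /eqP->.
apply: (PF _ r a b (hole_cycle H)) => //; rewrite ?mem_head //.
- rewrite (in_cons b) (in_cons a); apply/norP; split.
    by apply: contraTneq rb => ->; rewrite edge_irrefl.
  apply/norP; split; first by apply: contraTneq ra => ->; rewrite edge_irrefl.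
  by apply: contra nr; apply: Wp'.
- by rewrite !inE eqxx orbT.
Qed.

(** If [y] sees [W], the path [p] is left at its first node that sees [W], and the detour leads back
    to [y]. Otherwise the detour replaces the stretch between the first and the last node of [p]
    that see [W]. The ends [qa] and [qb] of the detour may coincide, but they see distinct nodes of
    the old cycle: if they are equal, that node is a center for the old cycle. *)
Lemma reroute y p W a0 b0 : hole y p -> connected W ->
  (forall z, z \in y :: p -> ~~ W z) ->
  a0 \in y :: p -> b0 \in p -> att W a0 -> att W b0 -> a0 != b0 ->
  (a0 == y) || ~~ edge a0 b0 ->
  exists p' (qa qb a b : G),
    [/\ hole y p', forall z, z \in p' -> z \in p \/ W z,
        [/\ qa \in p', W qa, edge qa a & a \in y :: p],
        [/\ qb \in p', W qb, edge qb b & b \in y :: p] & a != b].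
Proof.
move=> Hyp cW nW a0p b0p aa ab ab0 nab.
case/and4P: (Hyp) => sp yp Ip /allP Ay; have Up := ipath_uniq Ip.
have nWp z : z \in p -> ~~ W z by move=> zp; apply: nW; rewrite inE zp orbT.
have neW z w : z \in p -> W w -> (w == z) = false.
  by move=> zp; apply: contraTF => /eqP->; apply: nWp.
have noatt (r : seq G) z w : ~~ has (att W) r -> z \in r -> W w -> edge z w = false.
  move=> nr zr Ww; apply: contraNF nr => e; apply/hasP; exists z => //.
  by apply/attP; exists w.
have [ay|nay] := boolP (att W y).
  have /split_first[p1 [a [p2 [Ep aWa np1]]]] : has (att W) p by apply/hasP; exists b0.
  have ap : a \in p by rewrite Ep mem_cat mem_head orbT.
  have [q0 [q [Iq Wq Hq]]] := att_ipath cW aWa ay (nWp _ ap).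
  have Wq' z : z \in q0 :: q -> W z by move/(allP Wq).
  have yq : y \notin q0 :: q.
    by apply: contra (nW _ (mem_head _ _)); apply: Wq'.
  have ya : y != a by apply: contraNneq yp => ->.
  have e1 : edge q0 a by case/and3P: Iq => _ /andP[]; rewrite edge_sym eqxx => /eqP.
  have e2 : edge (last q0 q) y by rewrite edge_sym Hq ?eqxx // mem_last.
  (* If [a] is the last node of [p], its edge to [y] would become a chord, so the new cycle goes
     from [y] straight to [a] and drops [p1]. *)
  case: p2 Ep => [|d p2] Ep.
    exists (a :: q0 :: q), q0, (last q0 q), a, y; split=> //.
    - apply/and4P; split=> //; first by rewrite in_cons (negbTE ya).
      apply/allP=> z; rewrite in_cons => /predU1P[->|zq].
        by rewrite (eqP (Ay _ ap)) Ep last_cat /= eqxx orbT eqxx.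
      by rewrite Hq //= (neW a) ?Wq'.
    - by move=> z; rewrite in_cons => /predU1P[->|/Wq']; [left|right].
    - by split; rewrite ?in_cons ?eqxx ?ap ?orbT ?Wq' // mem_head.
    - split=> //; [|by apply/Wq'/mem_last|exact: mem_head].
      by rewrite in_cons mem_last orbT.
    - by rewrite eq_sym.
  have Ia := Ip; rewrite Ep in Ia; case/ipath_cat: Ia => Ip1 Iap2 X1.
  have hE (r : seq G) : head y (p1 ++ a :: r) = head y p by rewrite Ep; case: (p1).
  have hW z : W z -> (z == head y p) = false.
    move=> Wz; apply: contraTF Wz => /eqP->; apply: nW.
    by rewrite in_cons; case: (p) sp => //= b p' _; rewrite mem_head orbT.
  exists (p1 ++ a :: q0 :: q), q0, (last q0 q), a, y; split=> //.
  - apply/and4P; split=> //.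
    + by rewrite size_cat /= !addnS.
    + rewrite mem_cat (in_cons a) (negbTE ya) (negbTE yq) !orbF.
      by apply: contra yp; rewrite Ep mem_cat => ->.
    + apply/ipath_cat; split=> // c w cp1; rewrite in_cons => /predU1P[->|wq].
        by have [ca ->] := X1 c a cp1 (mem_head _ _).
      have cp : c \in p by rewrite Ep mem_cat cp1.
      rewrite (noatt p1 c w) ?Wq' // /= (neW a) ?Wq' ?andbF //; split=> //.
      by rewrite eq_sym (neW c) ?Wq'.
    + have lp : last y p = last d p2 by rewrite Ep last_cat.
      have lp1 z : z \in p1 ++ [:: a] -> (z == last y p) = false.
        move=> zp1; rewrite lp; apply/negbTE/eqP=> zl.
        have := Up; rewrite Ep -cat1s catA cat_uniq => /and3P[_ /hasP[]].
        by exists z; rewrite // zl mem_last.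
      apply/allP=> z; rewrite last_cat /= hE mem_cat in_cons => /or3P[zp1|/eqP->|zq].
      * have zp : z \in p by rewrite Ep mem_cat zp1.
        rewrite (eqP (Ay z zp)) lp1 ?mem_cat ?zp1 // orbF.
        rewrite [z == last q0 q](_ : _ = false) ?orbF //.
        by rewrite eq_sym neW // Wq' ?mem_last.
      * rewrite (eqP (Ay a ap)) lp1 ?mem_cat ?mem_head ?orbT // orbF.
        rewrite [a == last q0 q](_ : _ = false) ?orbF //.
        by rewrite eq_sym neW // Wq' ?mem_last.
      by rewrite Hq // hW ?Wq'.
  - move=> z; rewrite mem_cat in_cons => /or3P[zp1|/eqP->|/Wq']; [left| |right] => //.
      by rewrite Ep mem_cat zp1.
    by left.
  - by split; rewrite ?mem_cat ?in_cons ?eqxx ?ap ?orbT // Wq' // mem_head.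
  - split=> //; [|by apply/Wq'/mem_last|exact: mem_head].
    by rewrite mem_cat in_cons mem_last !orbT.
  - by rewrite eq_sym.
have nayW w : W w -> edge y w = false.
  by move=> Ww; apply: contraNF nay => e; apply/attP; exists w.
have a0y : a0 != y by apply: contraNneq nay => <-.
have {}a0p : a0 \in p by move: a0p; rewrite in_cons (negbTE a0y).
move: nab; rewrite (negbTE a0y) /= => nab.
have /split_first[p1 [a [r [Ep aWa np1]]]] : has (att W) p by apply/hasP; exists b0.
have inr z : z \in p -> att W z -> z \in a :: r.
  rewrite Ep mem_cat => /orP[zp1 az|//].
  by case/hasP: np1; exists z.
have /split_last[p2 [b [p3 [Er aWb np3]]]] : has (att W) r.
  apply/hasP; move: (inr _ a0p aa) (inr _ b0p ab); rewrite !in_cons.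
  case/predU1P=> [a0a|a0r]; last by exists a0.
  case/predU1P=> [b0a|b0r]; last by exists b0.
  by rewrite a0a b0a eqxx in ab0.
have ap : a \in p by rewrite Ep mem_cat mem_head orbT.
have bp : b \in p by rewrite Ep Er !(mem_cat, in_cons) eqxx !orbT.
have [q0 [q [Iq Wq Hq]]] := att_ipath cW aWa aWb (nWp _ ap).
have Wq' z : z \in q0 :: q -> W z by move/(allP Wq).
have Ia := Ip; rewrite Ep Er in Ia; case/ipath_cat: Ia => Ip1 Ia X1.
move: (Ia); rewrite -cat_cons => /ipath_cat[Iap2 Ib X2].
have Uar : uniq (a :: p2 ++ b :: p3).
  by move: Up; rewrite Ep Er cat_uniq => /and3P[].
(* If [a] and [b] were consecutive, they would be the only nodes of [p] that see [W], whereas [a0]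
   and [b0] are distinct and nonadjacent. *)
have p2n : p2 != [::].
  apply/eqP=> p20; move: nab; have eab : edge a b.
    by have [|_ ->] := X2 a b (mem_head _ _); rewrite ?mem_head // p20 /= !eqxx.
  have inab z : z \in p -> att W z -> (z == a) || (z == b).
    move=> zp az; move: (inr z zp az); rewrite Er p20 !in_cons => /or3P[->|->|zp3] //.
      by rewrite orbT.
    by case/hasP: np3; exists z.
  move: ab0; case/orP: (inab _ a0p aa) => /eqP->; case/orP: (inab _ b0p ab) => /eqP->;
  by rewrite ?eqxx // ?eab // edge_sym eab.
have aX d : d \in b :: p3 -> a != d /\ edge a d = false.
  move=> db; have [|ad ->] := X2 a d _ db; first by rewrite mem_head.
  split=> //; rewrite /=; case: (p2) p2n Uar => //= c p4 _ /andP[+ _].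
  rewrite inE negb_or mem_cat negb_or => /andP[ac /andP[ap4 _]].
  rewrite [a == _](_ : _ = false) //; apply/negbTE/eqP=> aE.
  by have := mem_last c p4; rewrite -aE in_cons (negbTE ac) (negbTE ap4).
have p3p z : z \in b :: p3 -> z \in p.
  by rewrite Ep Er !(mem_cat, in_cons) => ->; rewrite !orbT.
have p1p z : z \in p1 -> z \in p by rewrite Ep mem_cat => ->.
set p' := p1 ++ (a :: q0 :: q) ++ b :: p3.
have memp' z : z \in p' -> [\/ z \in p1, z = a, z \in q0 :: q | z \in b :: p3].
  rewrite /p' !mem_cat (in_cons a) -orbA => /or4P[|/eqP||];
  by [constructor 1|constructor 2|constructor 3|constructor 4].
have hE : head y p' = head y p by rewrite /p' Ep; case: (p1).
have lE : last y p' = last y p by rewrite /p' Ep Er !last_cat /= last_cat.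
have e1 : edge q0 a by case/and3P: Iq => _ /andP[]; rewrite edge_sym eqxx => /eqP.
have e2 : edge (last q0 q) b by rewrite edge_sym Hq ?eqxx // mem_last.
exists p', q0, (last q0 q), a, b; split=> //.
- apply/and4P; split=> //.
  + by rewrite /p' !size_cat /= !addnS.
  + apply/negP=> /memp'[/p1p yp1|yE|/Wq' Wy|/p3p yp3].
    * by rewrite yp1 in yp.
    * by rewrite yE ap in yp.
    * by have := nW y (mem_head _ _); rewrite Wy.
    by rewrite yp3 in yp.
  + apply/ipath_cat; split=> //.
      apply/ipath_cat; split=> // c d; rewrite in_cons => /predU1P[->|cq] db.
        have [ad ->] := aX d db; split=> //=.
        by rewrite [a == _]eq_sym neW // Wq' // mem_last.
      split; first by rewrite neW ?Wq' // p3p.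
      move: db; rewrite in_cons => /predU1P[->|dp3].
        by rewrite edge_sym Hq //= eqxx andbT.
      rewrite edge_sym (noatt p3) ?Wq' //= [d == b](_ : _ = false) ?andbF //.
      case/andP: Ib => bp3 _; by apply: contraNF bp3 => /eqP <-.
    move=> c d cp1; rewrite mem_cat in_cons => /orP[/predU1P[->|dq]|db].
    * by have [ca ->] := X1 c a cp1 (mem_head _ _).
    * rewrite (noatt p1) ?Wq' //= (neW a) ?Wq' ?andbF //; split=> //.
      by rewrite eq_sym neW ?Wq' // p1p.
    have [|cd ->] := X1 c d cp1; first by rewrite in_cons mem_cat db !orbT.
    by [].
  apply/allP=> z /memp'[/p1p/Ay|->|zq|/p3p/Ay]; rewrite hE lE //.
    exact: Ay.
  rewrite nayW ?Wq' // eq_sym eqbF_neg; apply/norP; split.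
    apply: contraTneq (Wq' _ zq) => ->; apply: nW.
    by case: (p) sp => // c p4 _; rewrite !inE eqxx orbT.
  by apply: contraTneq (Wq' _ zq) => ->; apply: nW; apply: mem_last.
- by move=> z /memp'[/p1p|->|/Wq'|/p3p]; [left|left|right|left].
- split=> //; [|by apply/Wq'/mem_head|by rewrite in_cons ap orbT].
  by rewrite /p' !mem_cat !in_cons eqxx !orbT.
- split=> //; [|by apply/Wq'/mem_last|by rewrite in_cons bp orbT].
  by rewrite /p' mem_cat mem_cat (in_cons a) mem_last !orbT.
have [] := aX b (mem_head _ _) => //.
Qed.

End Holes.

(** * Cliques separating two nodes *)

Section Separation.
Variable G : sgraph.
Implicit Types (x y z u v w c : G) (p q s : seq G) (W D : pred G).

Lemma hole_rev y p : hole y p -> hole y (rev p).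
Proof.
case/and4P=> sp yp Ip /allP Ay; apply/and4P; split.
- by rewrite size_rev.
- by rewrite mem_rev.
- exact: ipath_rev.
have rE (r : seq G) : last y (rev r) = head y r.
  by case: r => //= a r; rewrite rev_cons last_rcons.
apply/allP=> z; rewrite mem_rev => /Ay.
by rewrite rE -(rE (rev p)) revK orbC.
Qed.

Lemma hole_att y p c : hole y p -> c \in y :: p -> att (mem (y :: p)) c.
Proof.
move=> H cp; have [q [Hq E]] := cycle_hole (hole_cycle H) cp.
case/and4P: Hq => sq _ _ /allP A; case: q sq E A => // a q _ E A.
apply/attP; exists a; first by rewrite /= E !inE eqxx orbT.
by rewrite (eqP (A a (mem_head _ _))) /= eqxx.
Qed.

Lemma wedge_sym W : connect_sym (wedge W).
Proof.
by apply: sym_connect_sym => a b; rewrite /= edge_sym [W a && _]andbC.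
Qed.

Lemma connectedP W :
  (forall a b, W a -> W b -> connect (wedge W) a b) -> connected W.
Proof.
move=> H a b Wa Wb; have /connectP[p pp ->] := H _ _ Wa Wb.
exists p; first by apply: sub_path pp => c d /and3P[].
split=> //; by elim: p a {Wa} pp => //= c p IH a /andP[/and3P[_ _ ->] /IH].
Qed.

Lemma connected_wedge W a b : connected W -> W a -> W b -> connect (wedge W) a b.
Proof.
move=> cW Wa Wb; have [p pp [Wp <-]] := cW _ _ Wa Wb.
apply/connectP; exists p => //.
elim: p a Wa pp Wp {cW} => //= c p IH a Wa /andP[-> pp] /andP[Wc Wp].
by rewrite Wa Wc /=; apply: IH.
Qed.

Lemma wedge_sub W W' a b : (forall c, W c -> W' c) ->
  connect (wedge W) a b -> connect (wedge W') a b.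
Proof.
move=> sW; apply: connect_sub => c d /and3P[e Wc Wd].
by apply: connect1; rewrite /= e !sW.
Qed.

Lemma connected_root W r : W r ->
  (forall b, W b -> connect (wedge W) r b) -> connected W.
Proof.
move=> Wr H; apply: connectedP => a b Wa Wb.
by apply: connect_trans (H _ Wb); rewrite wedge_sym H.
Qed.

Lemma eq_connected W W' : W =1 W' -> connected W -> connected W'.
Proof.
move=> E cW; apply: connectedP => a b; rewrite -!E => Wa Wb.
by apply: (wedge_sub (W := W)) (connected_wedge _ _ _) => // c; rewrite E.
Qed.

Lemma connectedU W W' a b : connected W -> connected W' -> W a -> W' b ->
  a = b \/ edge a b -> connected (fun z => W z || W' z).
Proof.
move=> cW cW' Wa Wb ab.
have sW c : W c -> W c || W' c by move=> ->.
have sW' c : W' c -> W c || W' c by move=> ->; rewrite orbT.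
apply: (connected_root (r := a)) => [|c /= /orP[Wc|Wc]]; first exact: sW.
  by apply: (wedge_sub sW); apply: connected_wedge.
apply: connect_trans (wedge_sub sW' (connected_wedge cW' Wb Wc)).
case: ab => [->|e]; first exact: connect0.
by apply: connect1; rewrite /= e Wa Wb orbT.
Qed.

Lemma connected1 v : connected (pred1 v).
Proof. by move=> a b /eqP-> /eqP->; exists [::]. Qed.

Lemma path_connected v s : path (@edge G) v s -> connected (mem (v :: s)).
Proof.
elim: s v => [|a s IH] v.
  by move=> _; apply: (eq_connected (W := pred1 v)) (@connected1 v) => b; rewrite /= inE.
case/andP=> e /IH cs.
apply: (eq_connected (W := (fun z => pred1 v z || mem (a :: s) z))) => [b|].
  by rewrite /= !inE.
by apply: (connectedU (a := v) (b := a) (@connected1 v) cs); rewrite /= ?inE ?eqxx //; right.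
Qed.

Lemma ipath_connected s : ipath s -> connected (mem s).
Proof. by case: s => [|a s] // /ipath_path/path_connected. Qed.

(** A node of [p] adjacent to [u] is an end of [p], so its deletion leaves a path. As [p] has at
    least two nodes, the other end survives, and it is adjacent to [u]. *)
Lemma hole_minus u p (K : pred G) : hole u p ->
  {in p, forall k, K k -> edge u k} ->
  {in p &, forall k k', K k -> K k' -> k = k'} ->
  connected (fun z => (z \in p) && ~~ K z) /\
  att (fun z => (z \in p) && ~~ K z) u.
Proof.
move=> H Ku K1.
have [/hasP[k kp Kk]|nK] := boolP (has K p); last first.
  case/and4P: (H) => sp up Ip /allP Au.
  have RE : mem p =1 (fun z => (z \in p) && ~~ K z).
    move=> z /=; apply/idP/andP => [zp|[]//]; split=> //.
    by apply: contra nK => Kz; apply/hasP; exists z.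
  split; first exact: (eq_connected RE (ipath_connected Ip)).
  apply/attP; exists (head u p).
    by rewrite -RE; case: (p) sp => //= a q _; rewrite mem_head.
  by case: (p) sp Au => //= a q _ /(_ a (mem_head _ _))/eqP->; rewrite eqxx.
wlog hk : p H Ku K1 kp / head u p = k.
  move=> WL; case/and4P: (H) => sp up Ip /allP Au.
  move: (Ku k kp Kk); rewrite (eqP (Au k kp)) => /orP[/eqP|/eqP] kE.
    exact: (WL p).
  have rE : (fun z => (z \in rev p) && ~~ K z) =1 (fun z => (z \in p) && ~~ K z).
    by move=> z; rewrite mem_rev.
  have [||||cR aR] := WL (rev p) (hole_rev H).
  - by move=> a; rewrite mem_rev; apply: Ku.
  - by move=> a b; rewrite !mem_rev; apply: K1.
  - by rewrite mem_rev.
  - by rewrite kE; case/lastP: (p) => //= q a; rewrite rev_rcons last_rcons.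
  split; first exact: (eq_connected rE cR).
  by case/attP: aR => q; rewrite rE => Rq e; apply/attP; exists q.
case/and4P: (H) => sp up Ip /allP Au.
case: p => [|k' p] // in H sp up Ip Au Ku K1 kp hk *.
rewrite /= in hk; subst k'; case/and3P: (Ip) => kp' _ Ip'.
have RE : mem p =1 (fun z => (z \in k :: p) && ~~ K z).
  move=> z /=; rewrite inE; apply/idP/andP => [zp|[/predU1P[->|->//]]]; last by rewrite Kk.
  rewrite zp orbT; split=> //; apply: contra kp' => Kz.
  by rewrite (K1 k z) // ?mem_head // inE zp orbT.
split; first exact: (eq_connected RE (ipath_connected Ip')).
have lp : last k p \in p by case: (p) sp => //= a q _; apply: mem_last.
apply/attP; exists (last k p); first by rewrite -RE.
by rewrite (eqP (Au _ _)) /= ?eqxx ?orbT // inE lp orbT.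
Qed.

End Separation.

(** * A component [D] that [y] does not see and that meets no cycle through [y] *)

Section Bridge.
Variables (G : sgraph) (x y : G) (D : pred G).
Hypotheses (PF : propeller_free G) (cD : connected D) (xy : x != y).
Hypotheses (nDx : ~~ D x) (nDy : ~~ D y) (naDy : ~~ att D y).
Hypothesis ND : forall p, hole y p -> x \notin p -> {in p, forall q, ~~ D q}.
Implicit Types (u v w c r t : G) (p s : seq G) (T : pred G).

Lemma attW (W W' : pred G) u : (forall z, W z -> W' z) -> att W u -> att W' u.
Proof. by move=> sW /attP[q /sW Wq e]; apply/attP; exists q. Qed.

Lemma cycle_notD p : hole y p -> x \notin p -> {in y :: p, forall q, ~~ D q}.
Proof.
by move=> H xp q; rewrite inE => /predU1P[->//|]; apply: ND.
Qed.

(** If [c] and [u] were nonadjacent, [reroute] would produce a cycle through [y] that meets [D],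
    against [ND]. *)
Lemma att_clique p c u : hole y p -> x \notin p -> c \in p -> u \in p ->
  att D c -> att D u -> c != u -> edge c u.
Proof.
move=> H xp cp up ac au cu; apply/negPn/negP=> ncu.
have [||p' [qa [qb [a [b [H' sp' [q1 Dq1 _ _] _ _]]]]]] :=
    @reroute G y p D c u H cD (cycle_notD H xp) _ up ac au cu.
- by rewrite inE cp orbT.
- by rewrite ncu orbT.
have xp' : x \notin p'.
  by apply/negP=> /sp'[/(negP xp)|/(negP nDx)].
by have := ND H' xp' q1; rewrite Dq1.
Qed.

(* If [w] were [y] or not adjacent to [c], rerouting the cycle through
   [D] and [T] would put a node of [D] on a cycle through [y]. *)
Lemma first_att p T t0 c w : hole y p -> x \notin p ->
  connected (fun z => D z || T z) ->
  (forall z, T z -> z \notin y :: p /\ z != x) -> T t0 ->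
  (forall t e, T t -> e \in y :: p -> edge t e -> t = t0) ->
  c \in p -> att D c -> w \in y :: p -> edge t0 w ->
  w != y /\ (w = c \/ edge w c).
Proof.
move=> H xp cW nT Tt0 Ut cp ac wp tw.
suff no : w != c -> (w == y) || ~~ edge w c -> False.
  have wy : w != y.
    apply/negP=> wy; apply: no; last by rewrite wy.
    by rewrite (eqP wy); apply: contraNneq naDy => ->.
  split=> //; have [|wc] := eqVneq w c; [by left|right].
  by apply/negPn/negP=> nwc; apply: no; rewrite ?nwc ?orbT.
move=> wc wyc.
have [|||p' [qa [qb [a [b [H' sp' [q1 Wq1 qaa ap] [q2 Wq2 qbb bp] ab]]]]]] :=
    @reroute G y p _ w c H cW _ wp cp _ _ wc wyc.
- move=> z zp; rewrite negb_or (cycle_notD H xp zp) /=.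
  by apply/negP=> /nT[]; rewrite zp.
- by apply/attP; exists t0; rewrite ?Tt0 ?orbT // edge_sym.
- by apply: attW ac => z ->.
have xp' : x \notin p'.
  apply/negP=> /sp'[/(negP xp)//|/orP[/(negP nDx)//|/nT[_]]]; by rewrite eqxx.
move: Wq1 Wq2; rewrite (negbTE (ND H' xp' q1)) (negbTE (ND H' xp' q2)) /= => T1 T2.
have ea := Ut _ _ T1 ap qaa; have eb := Ut _ _ T2 bp qbb; subst qa qb.
by apply: (PF (hole_cycle H) _ ap bp ab qaa qbb); have [] := nT _ T1.
Qed.

(** * Two nonadjacent attachments [u], [v] of [D] *)

Section Pair.
Variables (u v : G) (pu pv : seq G).
Hypotheses (Hu : hole y pu) (Hv : hole y pv) (xu : x \notin pu) (xv : x \notin pv).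
Hypotheses (up : u \in pu) (vp : v \in pv) (au : att D u) (av : att D v).
Hypotheses (uv : u != v) (nuv : ~~ edge u v).

Lemma other_notin : v \notin y :: pu.
Proof.
rewrite inE; apply/negP=> /predU1P[vy|vu]; first by move: naDy; rewrite -vy av.
by move/negP: nuv; apply; apply: att_clique Hu xu up vu au av uv.
Qed.

Lemma connectedD1 : connected (fun z => D z || pred1 v z).
Proof.
case/attP: av => q Dq e; apply: (connectedU (a := q) (b := v) cD (@connected1 _ v)) => //=.
by right; rewrite edge_sym.
Qed.

Lemma v_x : v != x.
Proof. by apply: contraTneq vp => ->. Qed.

(** The case of [first_att] in which [T] consists of [v] alone. *)
Lemma direct_att w : w \in y :: pu -> edge v w -> [/\ w != y, edge w u & w != u].
Proof.
move=> wp vw.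
have [||t e /= /eqP->//|wy wu] := @first_att pu (pred1 v) v u w Hu xu connectedD1 _ _ _ up au wp vw.
- by move=> z /eqP->; rewrite other_notin v_x.
- exact: eqxx.
have nwu : w != u by apply: contraNneq nuv => <-; rewrite edge_sym.
by split=> //; case: wu => // wu; rewrite wu eqxx in nwu.
Qed.

(** Apart from [u], at most one node of the cycle has to be deleted. Every such node is adjacent to
    [u]; two of them would be adjacent to each other by [att_clique] or [first_att], and then [u]
    would be a center by [no_att_triangle], applied to [D] or to [D] with [v]. So [hole_minus]
    applies. *)
Lemma side r : r != y -> edge r u -> edge r v ->
  let R := fun z => (z \in y :: pu) && ~~ (att D z || (z == r)) in
  [/\ connected R, att R u & R y].
Proof.
move=> ry ru rv R.
have ucp : u \in y :: pu by rewrite inE up orbT.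
have [pu' [Hu' E]] := cycle_hole (hole_cycle Hu) ucp.
pose K z := att D z || (z == r).
have inpu k : k \in pu' -> K k -> k \in y :: pu /\ k != u.
  move=> kp _; split; first by rewrite E inE kp orbT.
  by apply: contraTneq kp => ->; case/and4P: Hu'.
have inpu1 k : k \in y :: pu -> att D k -> k \in pu.
  by rewrite inE => /predU1P[->|//]; rewrite (negbTE naDy).
have ruK k : K k -> k \in y :: pu -> k != u -> edge k u.
  case/orP=> [ak kp ku|/eqP-> //].
  by apply: (att_clique Hu xu) => //; apply: inpu1.
have nDp := cycle_notD Hu xu.
have [] := @hole_minus G u pu' K Hu'.
- by move=> k kp Kk; have [kp' ku] := inpu k kp Kk; rewrite edge_sym ruK.
- move=> k k' kp kp' Kk Kk'; apply/eqP/negPn/negP=> kk'.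
  have [ky ku] := inpu k kp Kk; have [ky' ku'] := inpu k' kp' Kk'.
  have eku := ruK k Kk ky ku; have eku' := ruK k' Kk' ky' ku'.
  have tri a b : a \in y :: pu -> b \in y :: pu -> a != u -> b != u ->
      edge a u -> edge b u -> att D a -> K b -> a != b -> False.
    move=> ap bp aNu bNu eau ebu aa Kb ab; case/orP: (Kb) => [ab'|/eqP br].
      apply: (no_att_triangle PF cD (a := a) (b := b) (r := u)); rewrite ?nDp //.
      - by apply: (att_clique Hu xu); rewrite ?inpu1.
      - by rewrite edge_sym.
      - by rewrite edge_sym.
    subst b.
    have vr : edge v r by rewrite edge_sym.
    have vNp : {in y :: pu, forall z, ~~ (D z || (z == v))}.
      move=> z zp; rewrite negb_or nDp //=; apply: contraNneq other_notin => <-.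
      exact: zp.
    have [||t e /= /eqP->//|_ [rE|era]] :=
      @first_att pu (pred1 v) v a r Hu xu connectedD1 _ _ _ (inpu1 a ap aa) aa bp vr.
    - by move=> z /eqP->; rewrite other_notin v_x.
    - exact: eqxx.
    - by rewrite rE eqxx in ab.
    apply: (no_att_triangle PF connectedD1 (a := a) (b := r) (r := u)); rewrite /= ?vNp //.
    - by rewrite edge_sym.
    - by rewrite edge_sym.
    - by rewrite edge_sym.
    - by apply: attW aa => z ->.
    - by apply/attP; exists v; rewrite /= ?eqxx ?orbT.
  case/orP: (Kk) => [ak|/eqP kr]; first exact: (tri k k').
  apply: (tri k' k) => //; last by rewrite eq_sym.
  by case/orP: (Kk') => // /eqP k'r; rewrite kr k'r eqxx in kk'.
move=> cR aR.
have RE : (fun z => (z \in pu') && ~~ K z) =1 R.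
  move=> z; rewrite /R E inE; have [->|//] := eqVneq z u.
  by rewrite /K au !andbF.
split; first exact: (eq_connected RE cR).
  by case/attP: aR => q Rq e; apply/attP; exists q; rewrite -?RE.
by rewrite /R mem_head negb_or naDy eq_sym.
Qed.
End Pair.

Section CommonNeighbor.
Variables (u v : G) (pu pv : seq G).
Hypotheses (Hu : hole y pu) (Hv : hole y pv) (xu : x \notin pu) (xv : x \notin pv).
Hypotheses (up : u \in pu) (vp : v \in pv) (au : att D u) (av : att D v).
Hypotheses (uv : u != v) (nuv : ~~ edge u v).

Let vu : v != u. Proof. by rewrite eq_sym. Qed.
Let nvu : ~~ edge v u. Proof. by rewrite edge_sym. Qed.

(** [two_sides] with [D] on one side and the remainders of both cycles on the other. The remainders
    share [y], and no edge joins them to [D] because all nodes that see [D] have been deleted. *)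
Lemma no_common_neighbor r : r != y -> edge r u -> edge r v -> ~~ D r -> False.
Proof.
move=> ry ru rv nDr.
have [c1 a1 y1] := side Hu xu xv up vp au av uv nuv ry ru rv.
have [c2 a2 y2] := side Hv xv xu vp up av au vu nvu ry rv ru.
have nD1 := cycle_notD Hu xu; have nD2 := cycle_notD Hv xv.
have c12 := connectedU c1 c2 y1 y2 (or_introl erefl).
apply: (two_sides PF cD c12 (u := u) (v := v) (r := r)) => //=.
- move=> a b Da Rb.
  have [bp ab] : (b \in y :: pu) || (b \in y :: pv) /\ ~~ att D b.
    by case/orP: Rb => /andP[-> /norP[-> _]]; rewrite ?orbT.
  split.
    by apply: contraTneq Da => ->; case/orP: bp => [/nD1|/nD2].
  by apply: contra ab => e; apply/attP; exists a; rewrite // edge_sym.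
- by rewrite nD1 // inE up orbT.
- by rewrite nD2 // inE vp orbT.
- by rewrite au !andbF.
- by rewrite av !andbF.
- by apply: attW a1 => z ->.
- by apply: attW a2 => z ->; rewrite orbT.
- by rewrite eqxx !orbT !andbF.
Qed.

(** By [direct_att], a neighbor of [v] on the cycle through [u] would be a common neighbor of [u]
    and [v]. *)
Lemma not_direct_att w : w \in y :: pu -> ~~ edge v w.
Proof.
move=> wp; apply/negP=> vw.
have [wy wu _] := direct_att Hu xu xv up vp au av uv nuv wp vw.
by apply: (no_common_neighbor wy wu); rewrite 1?edge_sym // (cycle_notD Hu).
Qed.
End CommonNeighbor.

Section TwoAttachments.
Variables (u v : G) (pu pv : seq G).
Hypotheses (Hu : hole y pu) (Hv : hole y pv) (xu : x \notin pu) (xv : x \notin pv).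
Hypotheses (up : u \in pu) (vp : v \in pv) (au : att D u) (av : att D v).
Hypotheses (uv : u != v) (nuv : ~~ edge u v).

Let natt_v w : w \in y :: pu -> ~~ edge v w.
Proof. exact: (not_direct_att Hu Hv xu xv up vp au av uv nuv). Qed.

Let natt_u w : w \in y :: pv -> ~~ edge u w.
Proof.
have vu : v != u by rewrite eq_sym.
have nvu : ~~ edge v u by rewrite edge_sym.
exact: (not_direct_att Hv Hu xv xu vp up av au vu nvu).
Qed.

(** No node of [v :: s] sees the cycle through [u]. Hence [t], adjacent to the last of them, is not
    on that cycle and is the only link from this segment to it, which makes [first_att] applicable
    with the segment as [T]. *)
Lemma first_step p s t (r : seq G) : hole v p -> y :: pv =i v :: p -> p = s ++ t :: r ->
  ~~ has (att (mem (y :: pu))) s -> att (mem (y :: pu)) t ->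
  [/\ connected (mem (v :: rcons s t)),
      {in v :: rcons s t, forall z, z \notin y :: pu /\ z \in y :: pv},
      {in v :: rcons s t & y :: pu, forall z e, edge z e -> z = t}
    & exists w, [/\ w \in y :: pu, edge t w, w != y, w != u & edge w u]].
Proof.
move=> Hp E Ep ns at_.
have vN : v \notin y :: pu := other_notin Hu xu up au av uv nuv.
have Pp : path (@edge G) v p by case: (hole_cycle Hp) => _ /andP[]; rewrite /= rcons_path => /andP[].
have [Ps elt] : path (@edge G) v s /\ edge (last v s) t.
  by move: Pp; rewrite Ep cat_path /= => /and3P[].
have nas z : z \in v :: s -> forall e, e \in y :: pu -> ~~ edge z e.
  rewrite inE => /predU1P[->|zs] e ep; first exact: natt_v.
  apply: contra ns => ze; apply/hasP; exists z => //.
  by apply/attP; exists e.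
have tN : t \notin y :: pu.
  by apply: contraL elt => tp; apply: nas tp; apply: mem_last.
have cT : connected (mem (v :: rcons s t)).
  by apply: path_connected; rewrite rcons_path Ps.
have sub z : z \in v :: rcons s t -> z \in v :: s \/ z = t.
  by rewrite -rcons_cons mem_rcons inE => /predU1P[->|]; [right|left].
have nT : {in v :: rcons s t, forall z, z \notin y :: pu /\ z \in y :: pv}.
  move=> z zT; split.
    case: (sub z zT) => [zs|->//]; apply/negP=> zp.
    by have /attP[e ep] := hole_att Hu zp; apply/negP/nas.
  rewrite E; case: (sub z zT) => [|->]; rewrite Ep !inE !mem_cat ?inE ?eqxx ?orbT //.
  by case/orP=> ->; rewrite ?orbT.
have UT : {in v :: rcons s t & y :: pu, forall z e, edge z e -> z = t}.
  move=> z e zT ep ze; case: (sub z zT) => // zs.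
  by move/negP: (nas z zs e ep).
split=> //; case/attP: at_ => w wp tw; exists w.
have tT : t \in v :: rcons s t by rewrite -rcons_cons mem_rcons mem_head.
have cDT : connected (fun z => D z || mem (v :: rcons s t) z).
  case/attP: av => q Dq e; apply: (connectedU (a := q) (b := v) cD cT) => //=.
    exact: mem_head.
  by right; rewrite edge_sym.
have [z zT||wy wu] :=
    @first_att pu (mem (v :: rcons s t)) t u w Hu xu cDT _ tT _ up au wp tw.
- have [zu zv] := nT z zT; split=> //; apply: contraTneq zv => ->.
  by rewrite inE negb_or xy.
- exact: UT.
have nwu : w != u.
  by apply: contraTneq tw => ->; rewrite edge_sym; apply: natt_u; case: (nT t tT).
by split=> //; case: wu => // wu; rewrite wu eqxx in nwu.
Qed.

Lemma two_attachments_clique : False.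
Proof.
(* [t1] and [t2] are the first nodes of the cycle through [v], in the two
   directions from [v], that see the cycle through [u]. Their neighbors [w1] and
   [w2] there are neighbors of [u], so [w1] or [u] becomes the center. *)
have ucp : u \in y :: pu by rewrite inE up orbT.
have vcp : v \in y :: pv by rewrite inE vp orbT.
have [p [Hp E]] := cycle_hole (hole_cycle Hv) vcp.
have yv : y != v by apply: contraNneq naDy => ->.
have yp : y \in p by have := E y; rewrite mem_head inE (negbTE yv) /= => /esym.
have ay : att (mem (y :: pu)) y by apply: (hole_att Hu); apply: mem_head.
have /split_first[s1 [t1 [r [Ep a1 n1]]]] : has (att (mem (y :: pu))) p.
  by apply/hasP; exists y.
have [cT1 nT1 UT1 [w1 [w1p tw1 w1y w1u ew1]]] := first_step Hp E Ep n1 a1.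
have t1T : t1 \in v :: rcons s1 t1 by rewrite -rcons_cons mem_rcons mem_head.
(* [y] lies on both cycles, so it sees the cycle through [u], and it is not [t1], which is off that
   cycle. Hence some node beyond [t1] sees the cycle, and [t2] will differ from [t1]. *)
have yr : y \in r.
  move: yp; rewrite Ep mem_cat => /orP[ys|].
    by case/hasP: n1; exists y.
  rewrite inE => /predU1P[yt|//].
  by have [] := nT1 _ t1T; rewrite -yt mem_head.
have /split_last[m [t2 [s2 [Er a2 n2]]]] : has (att (mem (y :: pu))) r.
  by apply/hasP; exists y.
have Ep' : rev p = rev s2 ++ t2 :: rev (s1 ++ t1 :: m).
  by rewrite Ep Er -cat_cons catA rev_cat rev_cons -cats1 -catA.
have [||cT2 nT2 UT2 [w2 [w2p tw2 w2y w2u ew2]]] :=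
    @first_step _ _ _ _ (hole_rev Hp) _ Ep' _ a2.
- by move=> z; rewrite E !inE mem_rev.
- by rewrite has_rev.
have t2T : t2 \in v :: rcons (rev s2) t2 by rewrite -rcons_cons mem_rcons mem_head.
have t12 : t1 != t2.
  case/and4P: Hp => _ _ /ipath_uniq Up _; apply: contraTneq Up => tE.
  by rewrite Ep Er tE cat_uniq /= mem_cat mem_head orbT /= !andbF.
have [t1N t1v] := nT1 _ t1T; have [t2N t2v] := nT2 _ t2T.
(* If they are equal, this node sees both [t1] and [t2] on the cycle through [v]. *)
have [ew|nw] := eqVneq w1 w2.
  apply: (PF (hole_cycle Hv) (x := w1) _ t1v t2v t12); last 2 first.
  - by rewrite edge_sym.
  - by rewrite ew edge_sym.
  by apply: contraTN ew1 => wv; rewrite edge_sym; apply: natt_u.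
pose Z := fun z => mem (v :: rcons s1 t1) z || mem (v :: rcons (rev s2) t2) z.
have cZ : connected Z.
  by apply: (connectedU (a := v) (b := v) cT1 cT2); rewrite /= ?mem_head //; left.
have nZ : {in y :: pu, forall z, ~~ Z z}.
  move=> z zp; apply/negP=> /orP[/nT1|/nT2][]; by rewrite zp.
have nDp := cycle_notD Hu xu.
have Z1 : Z t1 by rewrite /Z /= t1T.
have Z2 : Z t2 by rewrite /Z /= t2T orbT.
(* If they are adjacent, the edge [w1 w2] closes up through [D] and [Z] to a cycle with center
   [u]. *)
have [ew|new] := boolP (edge w1 w2).
  have cDZ : connected (fun z => D z || Z z).
    case/attP: av => q Dq e; apply: (connectedU (a := q) (b := v) cD cZ) => //=.
      by rewrite /Z /= mem_head.
    by right; rewrite edge_sym.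
  apply: (no_att_triangle PF cDZ (a := w1) (b := w2) (r := u)) => //.
  - by rewrite edge_sym.
  - by rewrite edge_sym.
  - by apply/attP; exists t1; rewrite 1?edge_sym ?Z1 ?orbT.
  - by apply/attP; exists t2; rewrite 1?edge_sym ?Z2 ?orbT.
  - by rewrite negb_or nDp ?nZ.
  - by rewrite negb_or nDp ?nZ.
  - by rewrite negb_or nDp ?nZ.
(* Now [w1] and [w2] are the two neighbors of [u] on its cycle. The rest of that cycle and [Z]
   become the two sides for the center [u]. *)
have [pu0 [Hu0 Eu0]] := cycle_hole (hole_cycle Hu) ucp.
have [pu' [Hu' Eu' h1 h2]] :
    exists pu', [/\ hole u pu', y :: pu =i u :: pu', head u pu' = w1 & last u pu' = w2].
  case/and4P: (Hu0) => _ _ _ /allP Au0.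
  have inpu0 w : w \in y :: pu -> w != u -> w \in pu0.
    by rewrite Eu0 inE => /predU1P[->|//]; rewrite eqxx.
  have hl w : w \in y :: pu -> w != u -> edge w u -> w = head u pu0 \/ w = last u pu0.
    move=> wp wu; rewrite edge_sym (eqP (Au0 _ (inpu0 _ wp wu))).
    by case/orP=> /eqP; [left|right].
  case: (hl _ w1p w1u ew1) => e1; case: (hl _ w2p w2u ew2) => e2.
  - by rewrite e1 e2 eqxx in nw.
  - by exists pu0.
  - exists (rev pu0); split.
    + exact: hole_rev.
    + by move=> z; rewrite Eu0 !inE mem_rev.
    + by rewrite e1; case/lastP: (pu0) => //= q a; rewrite rev_rcons last_rcons.
    + by rewrite e2; case: (pu0) => //= a q; rewrite rev_cons last_rcons.
  by rewrite e1 e2 eqxx in nw.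
have [n Epu] : exists n, pu' = w1 :: rcons n w2.
  case/and4P: (Hu') => sp _ _ _; case: (pu') sp h1 h2 => //= a q sp -> lq.
  by case/lastP: q sp lq => // q b _; rewrite last_rcons => ->; exists q.
subst pu'; case/and4P: Hu' => _ uN Iu _.
have In : ipath (rcons n w2) by case/and3P: Iu.
have In' : ipath n by move: In; rewrite -cats1 => /ipath_cat[].
have np z : z \in n -> z \in y :: pu.
  by move=> zn; rewrite Eu' !inE mem_rcons inE zn !orbT.
have Uw := ipath_uniq Iu; rewrite /= mem_rcons rcons_uniq inE negb_or -andbA in Uw.
case/and4P: Uw => _ w1n w2n _.
have un : u \notin n by apply: contra uN => un; rewrite inE mem_rcons inE un !orbT.
have n0 : n != [::].
  by apply/eqP=> n0; move: Iu new; rewrite n0 /= eqxx => /and3P[_ /andP[/eqP->]].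
(* With two neighbors on the cycle through [u], the node [e] would be a center. *)
have only t w e : t \in y :: pu -> w \in y :: pu -> e \notin y :: pu -> edge e t -> edge e w -> t = w.
  move=> tp wp eN et ew; apply/eqP/negPn/negP=> tw.
  exact: (PF (hole_cycle Hu) eN tp wp tw et ew).
apply: (two_sides PF (ipath_connected In') cZ (u := w1) (v := w2) (r := u)) => //=.
- move=> a b an Zb; have ap := np a an; split.
    by apply: contraTneq Zb => <-; apply: nZ.
  apply/negP; rewrite edge_sym => eba; case/orP: Zb => /= bT.
    have bt := UT1 b a bT ap eba; subst b.
    by rewrite (only _ _ _ ap w1p t1N eba tw1) (negbTE w1n) in an.
  have bt := UT2 b a bT ap eba; subst b.
  by rewrite (only _ _ _ ap w2p t2N eba tw2) (negbTE w2n) in an.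
- exact: nZ.
- exact: nZ.
- case: (n) n0 Iu => // a q _ /and3P[_ /andP[]]; rewrite eqxx => /eqP e _ _.
  by apply/attP; exists a; rewrite //= mem_head.
- case/lastP: (n) n0 In => // q a _; rewrite -!cats1 => /ipath_cat[_ _ X].
  have [] := X a w2; rewrite ?mem_head ?mem_cat ?mem_head ?orbT // last_cat /= !eqxx => _ e.
  apply/attP; exists a; first by rewrite /= mem_cat mem_head orbT.
  by rewrite edge_sym.
- by apply/attP; exists t1; rewrite 1?edge_sym.
- by apply/attP; exists t2; rewrite 1?edge_sym.
- exact: nZ.
- by rewrite edge_sym.
- by rewrite edge_sym.
Qed.
End TwoAttachments.

End Bridge.

(** * The criterion: separation by cliques excludes propellers, and conversely *)

Section Characterization.
Variable G : sgraph.
Implicit Types (x y z u v w a b : G) (p s : seq G) (F D : pred G).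

(* Protecting [y] lets an algorithm run through all pairs [a], [b], and
   [a = x] or [b = x] covers cliques with fewer than two nodes. *)
Definition blocked x y a b : pred G := fun v => (v \in [:: x; a; b]) && (v != y).

Definition separated x y z : bool :=
  [exists a, exists b, [&& (a == b) || edge a b, ~~ blocked x y a b z
    & ~~ connect (wedge (fun v => ~~ blocked x y a b v)) y z]].

Lemma not_connect F D y z : D z -> ~~ D y ->
  (forall a b, D a -> F b -> edge a b -> D b) -> ~~ connect (wedge F) y z.
Proof.
move=> Dz nDy cl; rewrite (wedge_sym F); apply/connectP=> -[p pp yE].
case/negP: nDy; rewrite yE; elim: p z Dz pp {yE} => //= a p IH z Dz.
by case/andP=> /and3P[e _ Fa]; apply: IH; apply: cl e.
Qed.

(** The set U of the overview. A chordless path repeats no node, so bounding its length loses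
    nothing and makes membership boolean. *)
Definition onhole x y v :=
  (v == y) || [exists n : 'I_#|G|.+1, exists t : n.-tuple G,
                 [&& hole y t, x \notin t & v \in t]].

Lemma onholeP x y v :
  reflect (v = y \/ exists p, [/\ hole y p, x \notin p & v \in p]) (onhole x y v).
Proof.
apply: (iffP orP) => -[/eqP|]; [by left| |by left|].
  by case/existsP=> n /existsP[t /and3P[h xt vt]]; right; exists t.
case=> p [h xp vp]; right; have sp : size p < #|G|.+1.
  by case/and4P: h => _ _ /ipath_uniq/card_uniqP <- _; rewrite ltnS max_card.
apply/existsP; exists (Ordinal sp); apply/existsP; exists (in_tuple p).
by rewrite h xp vp.
Qed.

Lemma component_connected F z : F z -> connected (connect (wedge F) z).
Proof.
move=> Fz; set D := connect _ z; have Dz : D z by exact: connect0.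
have H p c : D c -> path (wedge F) c p -> connect (wedge D) c (last c p).
  elim: p c => [|a p IH] c Dc; first by move=> _; apply: connect0.
  rewrite [path _ _ _]/= => /andP[e pp].
  have Da : D a by apply: connect_trans Dc _; apply: connect1.
  apply: connect_trans _ (IH a Da pp); apply: connect1.
  by case/and3P: e => /= -> _ _; rewrite Dc Da.
by apply: (connected_root Dz) => b /connectP[p pp ->]; apply: H.
Qed.

Lemma component_sub F z w : F z -> connect (wedge F) z w -> F w.
Proof.
move=> Fz /connectP[p + ->]; elim: p z Fz => //= a p IH z _.
by case/andP=> /and3P[_ _ Fa]; apply: IH.
Qed.

Lemma component_closed F z a b :
  F z -> connect (wedge F) z a -> F b -> edge a b -> connect (wedge F) z b.
Proof.
move=> Fz za Fb e; apply: (connect_trans za); apply: connect1.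
by rewrite /= e Fb andbT; apply: component_sub za.
Qed.

Lemma nonadjacent_separated x y z : propeller_free G ->
  edge x y -> edge x z -> y != z -> ~~ edge y z -> separated x y z.
Proof.
move=> PF xy xz yz nyz.
have xNy : x != y by apply: contraTneq xy => ->; rewrite edge_irrefl.
have xNz : x != z by apply: contraTneq xz => ->; rewrite edge_irrefl.
pose F v := (v != x) && ~~ onhole x y v.
(* A cycle through [y] and [z] that avoids [x] would have [x] as a center. *)
have Fz : F z.
  rewrite /F eq_sym xNz /=; apply/onholeP=> -[zy|[p [Hp xp zp]]].
    by rewrite zy eqxx in yz.
  apply: (PF _ x y z (hole_cycle Hp)) => //; first by rewrite inE negb_or xNy.
    exact: mem_head.
  by rewrite inE zp orbT.
pose D := connect (wedge F) z.
have Dz : D z by exact: connect0.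
have cD : connected D := component_connected Fz.
have DF w : D w -> F w by apply: component_sub.
have Dcl a b : D a -> F b -> edge a b -> D b by apply: component_closed.
have nDx : ~~ D x by apply/negP=> /DF; rewrite /F eqxx.
have nDy : ~~ D y by apply/negP=> /DF; rewrite /F /onhole eqxx andbF.
have ND p : hole y p -> x \notin p -> {in p, forall q, ~~ D q}.
  move=> Hp xp q qp; apply/negP=> /DF/andP[_ /onholeP[]]; right.
  by exists p.
have sep a b : (a == b) || edge a b -> ~~ blocked x y a b z ->
    ~~ connect (wedge (fun v => ~~ blocked x y a b v)) y z -> separated x y z.
  by move=> ab bz cz; apply/existsP; exists a; apply/existsP; exists b; rewrite ab bz.
(* The neighborhood of [D] without [x], which is deleted anyway. *)
pose A u := [&& att D u, u != x & ~~ D u].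
have Aout a b : D a -> edge a b -> ~~ D b -> b != x -> A b.
  move=> Da e nDb bx; rewrite /A nDb bx !andbT; apply/attP.
  by exists a; rewrite // edge_sym.
have Ahole u : A u -> u != y -> exists p, [/\ hole y p, x \notin p & u \in p].
  case/and3P=> /attP[q Dq e] ux nDu uy.
  suff /onholeP[uE|//] : onhole x y u by rewrite uE eqxx in uy.
  apply: contraNT nDu => no; apply: (Dcl q); rewrite 1?edge_sym //.
  by rewrite /F ux.
have [ay|nay] := boolP (att D y).
  have /attP[t Dt yt] := ay.
  (* With a second neighbor in [D], a chordless path inside [D] from [t] to the first further
     neighbor of [y] would close up to a cycle through [y]. *)
  have Ut t' : D t' -> edge y t' -> t' = t.
    move=> Dt' yt'; apply/eqP/negPn/negP=> tt'.
    have [p pp [Dp lp]] := cD _ _ Dt Dt'.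
    have [|q [Iq /andP[yq tq] sq Uq]] :=
      @ipath_of_walk G [pred w | edge y w && (w != t)] _ _ pp.
      by rewrite /= lp yt' tt'.
    have Dtq : all D (t :: q) by rewrite /= Dt; apply/allP=> w /sq/(allP Dp).
    case: q => [|q0 q] in Iq yq tq sq Uq Dtq *; first by rewrite /= eqxx in tq.
    have Hq : hole y (t :: q0 :: q).
      apply/and4P; split=> //; first by apply: contra nDy => /(allP Dtq).
      apply/allP=> w wq; apply/eqP; apply/idP/orP => [yw|[/eqP->//|/eqP->//]].
      have [->|wt] := eqVneq w t; [by left|right]; apply/eqP.
      by apply: Uq; rewrite //= yw wt.
    have xq : x \notin t :: q0 :: q by apply: contra nDx => /(allP Dtq).
    by have := ND _ Hq xq t (mem_head _ _); rewrite Dt.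
  (* Any other node of [A] lies on a cycle through [y], and that cycle could be rerouted through
     [D]. So [D] can be left only by the edge from [t] to [y]. *)
  have Ay u : A u -> u = y.
    move=> Au; apply/eqP/negPn/negP=> uy.
    have [p [Hp xp up]] := Ahole u Au uy; case/and3P: Au => au _ _.
    have yp : y \notin p by case/and4P: Hp.
    have nDp c : c \in y :: p -> ~~ D c.
      by rewrite inE => /predU1P[->//|]; apply: ND xp _.
    have [||p' [qa [qb [a [b [H' sp' [q1 Dq1 _ _] _ _]]]]]] :=
      @reroute G y p D y u Hp cD nDp (mem_head _ _) up ay au.
    - by rewrite eq_sym.
    - by rewrite eqxx.
    have xp' : x \notin p' by apply/negP=> /sp'[/(negP xp)|/(negP nDx)].
    by have := ND _ H' xp' _ q1; rewrite Dq1.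
  have zt : z != t by apply: contraNneq nyz => ->.
  have yt' : t != y by apply: contraNneq nDy => <-.
  have Bt : blocked x y t t t by rewrite /blocked yt' !inE eqxx !orbT.
  have By : ~~ blocked x y t t y by rewrite /blocked eqxx andbF.
  have Bx : blocked x y t t x by rewrite /blocked xNy !inE eqxx.
  apply: (sep t t); first by rewrite eqxx.
    by rewrite /blocked !inE (negbTE zt) orbb orbF eq_sym (negbTE xNz).
  apply: (@not_connect _ [pred w | D w && (w != t)]) => /=.
  - by rewrite Dz.
  - by rewrite (negbTE nDy).
  move=> a b /andP[Da at_] nBb e; have bt : b != t by apply: contraNneq nBb => ->.
  rewrite bt andbT; apply/negPn/negP=> nDb.
  have bx : b != x by apply: contraNneq nBb => ->.
  have bE := Ay _ (Aout a b Da e nDb bx); subst b.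
  by move: at_; rewrite (Ut a) ?eqxx // edge_sym.
have Any u : A u -> u != y by case/and3P=> au _ _; apply: contraNneq nay => <-.
(* Here [y] is not in [A], so the exemption of [y] in [blocked] opens no way out of [D]. *)
have covers a b : (a == b) || edge a b -> ~~ blocked x y a b z ->
    (forall u, A u -> u \in [:: a; b]) -> separated x y z.
  move=> ab nBz cov; apply: (sep a b) => //; apply: (@not_connect _ D) => // c d Dc nBd e.
  apply/negPn/negP=> nDd.
  have Bx : blocked x y a b x by rewrite /blocked xNy !inE eqxx.
  have dx : d != x by apply: contraNneq nBd => ->.
  have Ad := Aout c d Dc e nDd dx; case/negP: nBd.
  by rewrite /blocked (Any _ Ad) in_cons cov ?orbT.
have ANz u : A u -> z == u = false.
  by case/and3P=> _ _ nDu; apply: contraNF nDu => /eqP <-.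
have zNx : z == x = false by rewrite eq_sym; apply/negbTE.
have [[u v] /= /and4P[Au Av uv nuv]|clA] :=
    @pickP _ [pred p : G * G | [&& A p.1, A p.2, p.1 != p.2 & ~~ edge p.1 p.2]].
  have [pu [Hu xu up]] := Ahole u Au (Any u Au).
  have [pv [Hv xv vp]] := Ahole v Av (Any v Av).
  case/and3P: Au Av => au _ _ /and3P[av _ _].
  by case: (two_attachments_clique PF cD xNy nDx nDy nay ND Hu Hv xu xv up vp au av uv nuv).
have {}clA u v : A u -> A v -> u != v -> edge u v.
  move=> Au Av uv; apply/negPn/negP=> nuv.
  by have := clA (u, v); rewrite /= Au Av uv nuv.
have [u Au|noA] := pickP A; last first.
  apply: (covers x x) => [||u]; rewrite ?eqxx ?noA //.
  by rewrite /blocked !inE zNx.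
have [v /andP[Av uv]|noA] := pickP [pred v | A v && (u != v)]; last first.
  apply: (covers u u) => [||v Av]; rewrite ?eqxx //.
    by rewrite /blocked !inE zNx ANz.
  by have := noA v; rewrite /= Av /= => /negbFE/eqP->; rewrite inE eqxx.
have uv' := clA u v Au Av uv.
apply: (covers u v) => [||w Aw]; first by rewrite uv' orbT.
  by rewrite /blocked !inE zNx (ANz u Au) (ANz v Av).
(* A third node of the clique would form a triangle with [u] and [v], which both see [D], and would
   be a center. *)
rewrite !inE; apply/negPn/negP; rewrite negb_or => /andP[wu wv].
case/and3P: (Au) (Av) (Aw) => au _ nu /and3P[av _ nv] /and3P[aw _ nw].
by apply: (no_att_triangle PF cD uv' (r := w)) => //; apply: clA.
Qed.

(** The fourth node provides a component [D] of the rest. If some node of the triangle did not see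
    [D], the other two would be a $K_2$-cutset. So [x] and [y] see [D], and [z] is a center. *)
Lemma triangle_propeller x y z : propeller_free G ->
  (forall a b : G, ~ K2_cutset a b) -> 3 < #|G| ->
  edge x y -> edge x z -> edge y z -> False.
Proof.
move=> PF nK2 cG xy xz yz.
have [w wN] : exists w, w \notin [:: x; y; z].
  apply/existsP; apply: contraLR cG; rewrite negb_exists => /forallP H.
  rewrite -leqNgt; apply: leq_trans (card_size [:: x; y; z]).
  by apply/subset_leq_card/subsetP=> w _; have := H w; rewrite negbK.
pose F v := v \notin [:: x; y; z].
have Fw : F w by [].
pose D := connect (wedge F) w.
have Dw : D w by exact: connect0.
have cD : connected D := component_connected Fw.
have DF v : D v -> F v by apply: component_sub.
have Dcl a b : D a -> F b -> edge a b -> D b by apply: component_closed.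
have at3 (r s t : G) : edge s t -> r != s -> r != t ->
    (forall v, v \in [:: x; y; z] = (v \in [:: r; s; t])) -> att D r.
  move=> st rs rt E; have [//|nar] := boolP (att D r); case: (nK2 s t); split=> //.
  have wS : w \in ~: [set s; t].
    move: wN; rewrite E !inE; by apply: contra => /orP[->|->]; rewrite !orbT.
  have rS : r \in ~: [set s; t] by rewrite !inE negb_or rs.
  exists (Sub w wS), (Sub r rS); apply/negP.
  have /closed_connect cl : closed (@edge (remove [set s; t])) [pred v | D (val v)].
    apply: intro_closed; first by apply: sym_connect_sym; apply: edge_sym.
    move=> [a aS] [b bS] e; rewrite !inE /= => Da.
    have eab : edge a b by [].
    apply: (Dcl a) => //; rewrite /F E !inE negb_or.
    have := bS; rewrite !inE => ->; rewrite andbT.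
    by apply: contraNneq nar => <-; apply/attP; exists a; rewrite // edge_sym.
  move/cl; rewrite !inE /= Dw => /esym/DF.
  by rewrite /F E mem_head.
have neq a b : edge a b -> a != b.
  by move=> e; apply: contraTneq e => ->; rewrite edge_irrefl.
have nD v : v \in [:: x; y; z] -> ~~ D v.
  by move=> vN; apply/negP=> /DF; rewrite /F vN.
have yx : edge y x by rewrite edge_sym.
have zx : edge z x by rewrite edge_sym.
have zy : edge z y by rewrite edge_sym.
apply: (no_att_triangle PF cD (a := x) (b := y) (r := z)) => //.
- by apply: (at3 x y z) => //; apply: neq.
- apply: (at3 y x z); rewrite ?neq // => v; rewrite !inE; by do 3!case: (_ == _).
- by apply: nD; rewrite !inE eqxx.
- by apply: nD; rewrite !inE eqxx orbT.
- by apply: nD; rewrite !inE eqxx !orbT.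
Qed.

(** As [x] is off the rim, the blocked nodes on it belong to the clique of [a] and [b]. When the rim
    is opened at one of them, at most one more is left, adjacent to the first, and [hole_minus]
    still connects [y] to [z]. With none, the rim itself does. *)
Lemma separated_propeller_free :
  (forall x y z, edge x y -> edge x z -> y != z -> separated x y z) ->
  propeller_free G.
Proof.
move=> H c x y z Cc xc yc zc yz xy xz.
have /existsP[a /existsP[b /and3P[ab nBz /negP[]]]] := H x y z xy xz yz.
pose K := blocked x y a b.
have nBy : ~~ K y by rewrite /K /blocked eqxx andbF.
have Kin k : k \in c -> K k -> k \in [:: a; b].
  move=> kc /andP[+ _]; rewrite in_cons => /predU1P[kx|//].
  by rewrite -kx kc in xc.
have [/hasP[k kc Kk]|nK] := boolP (has K c).
  have [p [Hp E]] := cycle_hole Cc kc.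
  have pc v : v \in p -> v \in c /\ v != k.
    move=> vp; rewrite E inE vp orbT; split=> //.
    by apply: contraTneq vp => ->; case/and4P: Hp.
  have inp v : v \in c -> ~~ K v -> v \in p.
    by rewrite E inE => /predU1P[->|//]; rewrite Kk.
  have [] := @hole_minus G k p K Hp.
  - move=> k' kp Kk'; have [kc' kk'] := pc k' kp.
    move: (Kin _ kc Kk) (Kin _ kc' Kk') ab kk'; rewrite !inE.
    by case/orP=> /eqP-> /orP[]/eqP->; rewrite ?eqxx // edge_sym;
       case/orP=> [/eqP->|//]; rewrite ?eqxx // edge_sym.
  - move=> k1 k2 kp1 kp2 K1 K2; have [kc1 kk1] := pc k1 kp1; have [kc2 kk2] := pc k2 kp2.
    move: (Kin _ kc Kk) (Kin _ kc1 K1) (Kin _ kc2 K2) kk1 kk2; rewrite !inE.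
    by case/orP=> /eqP-> /orP[]/eqP-> /orP[]/eqP->; rewrite ?eqxx.
  move=> cR _; apply: (wedge_sub (W := fun v => (v \in p) && ~~ K v)) => [v /andP[]//|].
  by apply: connected_wedge cR _ _; rewrite ?inp.
have [p [Hp E]] := cycle_hole Cc yc.
have cR : connected (mem (y :: p)).
  apply: path_connected; case: (hole_cycle Hp) => _ /andP[].
  by rewrite /= rcons_path => /andP[].
apply: (wedge_sub (W := mem (y :: p))) => [v /= vp|].
  by apply: contra nK => Kv; apply/hasP; exists v; rewrite ?E.
by apply: connected_wedge cR _ _; rewrite /= -E.
Qed.

End Characterization.

(** * Induced subgraphs, 2-connectedness and counting of arcs *)

Lemma chordless_cycle_induced (G : sgraph) (S : {set G}) (c : seq (induced S)) :
  chordless_cycle c <-> chordless_cycle (map val c).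
Proof.
have vI : injective (val : induced S -> G) by exact: (@val_inj _ _ {x : G | x \in S}).
have nE x : uniq c -> next (map val c) (val x) = val (next c x).
  by move=> U; rewrite (next_map vI U).
have uE : ucycle (@edge G) (map val c) = ucycle (@edge (induced S)) c.
  by rewrite /ucycle map_inj_uniq ?cycle_map.
rewrite /chordless_cycle size_map uE; split=> -[-> U H]; split=> //;
  have Uc : uniq c by case/andP: U.
  move=> _ _ /mapP[x xc ->] /mapP[y yc ->] e; rewrite !nE //.
  by case: (H x y xc yc e) => E; [left|right]; apply: (congr1 val E).
move=> x y xc yc e; have := H (val x) (val y); rewrite !nE // => H'.
by case: (H' (map_f val xc) (map_f val yc) e) => /vI; [left|right].
Qed.

Lemma in_C2P (G : sgraph) : in_C2 G <-> propeller_free G.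
Proof.
split=> [H c x a b Cc xc ac bc ab xa xb|PF S [c [x [Cc xc /card_gt1P[a [b [+ + ab]]] _]]]].
  pose S := [set z in x :: c]; apply: (H S).
  have xS : x \in S by rewrite inE mem_head.
  pose c' : seq (induced S) := pmap insub c.
  have cE : map val c' = c.
    rewrite (pmap_filter (insubK _)); apply/all_filterP/allP=> z zc.
    by rewrite /= insubT ?inE ?zc ?orbT.
  have memc z (zS : z \in S) : (Sub z zS \in c') = (z \in c).
    rewrite -cE; exact: (esym (mem_map (@val_inj _ _ {x : G | x \in S}) c' (Sub z zS))).
  have inS z : z \in c -> z \in S by move=> zc; rewrite inE in_cons zc orbT.
  exists c', (Sub x xS); split.
  - by apply/chordless_cycle_induced; rewrite cE.
  - by rewrite memc.
  - apply/card_gt1P; exists (Sub a (inS a ac)), (Sub b (inS b bc)).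
    by split; rewrite ?inE ?memc ?ac ?bc.
  case=> z zS; rewrite in_cons memc; have := zS.
  by rewrite inE in_cons.
rewrite !inE => /andP[ac xa] /andP[bc xb].
apply: (PF (map val c) (val x) (val a) (val b)) => //.
- exact/chordless_cycle_induced.
- by rewrite mem_map //; apply: val_inj.
- exact: map_f.
- exact: map_f.
Qed.

(** A single node is excluded by deleting nothing, two nodes by deleting one of them. *)
Lemma two_connected_card (G : sgraph) : 0 < #|G| -> two_connected G -> 2 < #|G|.
Proof.
move=> G0 H; rewrite ltnNge; apply/negP=> G2.
have cR (S : {set G}) : #|remove S| = #|G| - #|S|.
  rewrite -(cardsC S) addKn (_ : #|remove S| = #|{: {x : G | x \in ~: S}}|) //.
  by rewrite card_sig; apply: eq_card => x; rewrite inE.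
case: (posnP (#|G| - 1)) => [/eqP|G1].
  rewrite subn_eq0 => G1; have [|_] := H set0; first by rewrite cards0.
  by rewrite cR cards0 subn0; apply; apply/anti_leq; rewrite G1.
have /card_gt0P[v _] := G0.
have [|_] := H [set v]; first by rewrite cards1.
by rewrite cR cards1; apply; apply/anti_leq; rewrite G1 leq_subLR G2.
Qed.

(** With at least two nodes present, an isolated node would disconnect the graph. This yields n <=
    2m in the time bound. *)
Lemma two_connected_degree (G : sgraph) (x : G) :
  0 < #|G| -> two_connected G -> exists y, edge x y.
Proof.
move=> G0 H; have [|nd _] := H set0; first by rewrite cards0.
have /card_gt1P[a [b [_ _ ab]]] : 1 < #|G| by apply: ltnW (two_connected_card G0 H).
have [y xy] : exists y, x != y.
  by have [xa|xa] := eqVneq x a; [exists b; rewrite xa|exists a].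
have inS (z : G) : z \in ~: set0 by rewrite !inE.
have [/existsP//|] := boolP [exists y, edge x y].
rewrite negb_exists => /forallP ne; case: nd.
exists (Sub x (inS x)), (Sub y (inS y)); apply/negP=> /connectP[[|z p] /=].
  by move=> _ /(congr1 val) /= yx; rewrite yx eqxx in xy.
by case/andP=> e; have := ne (val z); rewrite (_ : edge x (val z)).
Qed.

(** An arc is determined by its edge and one bit, the order of its ends in the enumeration of the
    nodes. *)
Lemma arcs_leq (G : sgraph) : #|[pred p : G * G | edge p.1 p.2]| <= 2 * #|edges G|.
Proof.
pose f (p : G * G) := ([set p.1; p.2], enum_rank p.1 < enum_rank p.2).
have fI : injective f.
  move=> [a b] [c d] [/= /setP E] o.
  have := E c; have := E d; have := E a; have := E b; rewrite !inE !eqxx !orbT /=.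
  case/esym/orP=> /eqP bE; case/esym/orP=> /eqP aE; subst a b.
  - by rewrite orbb => /eqP->.
  - move: o; case: (ltngtP (enum_rank c) (enum_rank d)) => //.
    by move=> /ord_inj/enum_rank_inj->.
  - by [].
  by move=> _; rewrite orbb => /eqP->.
rewrite -(card_imset _ fI); apply: leq_trans (_ : #|setX (edges G) [set: bool]| <= _).
  apply/subset_leq_card/subsetP => _ /imsetP[p e ->]; rewrite !inE andbT.
  by apply/imsetP; exists p; rewrite ?inE.
by rewrite cardsX cardsT card_bool mulnC.
Qed.

(** * Running programs *)

(** Total correctness with a time bound. As [T] is only an upper bound, estimates can be rounded up
    and left to [lia]. *)
Definition runs (c : prog) (s : state) (T : nat) (Q : state -> Prop) : Prop :=
  exists s' t, [/\ exec c s s' t, t <= T & Q s'].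

Lemma runs_le c s T T' (Q Q' : state -> Prop) :
  runs c s T Q -> T <= T' -> (forall s', Q s' -> Q' s') -> runs c s T' Q'.
Proof.
move=> [s' [t [e tT q]]] TT' QQ'; exists s', t; split=> //; last exact: QQ'.
exact: leq_trans TT'.
Qed.

Lemma runs_skip s T (Q : state -> Prop) : 0 < T -> Q s -> runs Skip s T Q.
Proof. by move=> T0 q; exists s, 1; split=> //; constructor. Qed.

Lemma runs_assign r e s T (Q : state -> Prop) : cost e < T ->
  Q (State (upd (reg s) r (eval s e)) (Defs.mem s)) -> runs (Assign r e) s T Q.
Proof. by move=> T0 q; eexists; eexists; split; [constructor| |exact: q]. Qed.

Lemma runs_write e1 e2 s T (Q : state -> Prop) : cost e1 + cost e2 < T ->
  Q (State (reg s) (upd (Defs.mem s) (eval s e1) (eval s e2))) ->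
  runs (Write e1 e2) s T Q.
Proof. by move=> T0 q; eexists; eexists; split; [constructor| |exact: q]. Qed.

Lemma runs_seq T1 T2 c1 c2 s T (Q1 Q : state -> Prop) :
  runs c1 s T1 Q1 -> (forall s1, Q1 s1 -> runs c2 s1 T2 Q) ->
  T1 + T2 <= T -> runs (Seq c1 c2) s T Q.
Proof.
move=> [s1 [t1 [e1 l1 /[swap] H /H[s2 [t2 [e2 l2 q]]]]]] lT.
exists s2, (t1 + t2); split=> //; first exact: ExecSeq e1 e2.
by apply: leq_trans lT; apply: leq_add.
Qed.

Lemma runs_if T' e c1 c2 s T (Q : state -> Prop) : cost e + T' < T ->
  (eval s e != 0 -> runs c1 s T' Q) -> (eval s e = 0 -> runs c2 s T' Q) ->
  runs (If e c1 c2) s T Q.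
Proof.
move=> lT H1 H2; have [e0|e0] := eqVneq (eval s e) 0.
  have [s' [t [ex lt q]]] := H2 e0.
  exists s', (cost e + t).+1; split=> //; first by apply: ExecIfFalse ex; rewrite e0.
  by apply: leq_trans lT; rewrite ltnS leq_add2l.
have [s' [t [ex lt q]]] := H1 e0.
exists s', (cost e + t).+1; split=> //; first exact: ExecIfTrue ex.
by apply: leq_trans lT; rewrite ltnS leq_add2l.
Qed.

(* Register [1] is meant to hold the number of nodes: register [i] runs through
   the nodes and register [i.+1] holds the address of the corresponding row. *)
Definition Loop i body :=
  Seq (Assign i (Cst 0)) (Seq (Assign i.+1 (Cst 1))
    (While (Defs.Sub (Reg 1) (Reg i))
      (Seq body (Seq (Assign i (Add (Reg i) (Cst 1)))
                     (Assign i.+1 (Add (Reg i.+1) (Reg 1))))))).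

Section Machine.
Variable G : sgraph.
Implicit Types (s : state) (x y z u v w a b : G) (p q : seq G).
Let n := #|G|.

Definition rank v := index v (enum G).
Definition row v := 1 + rank v * n.

Lemma rank_lt v : rank v < n.
Proof. by rewrite /n cardE index_mem mem_enum. Qed.

Lemma rank_inj : injective rank.
Proof.
move=> u v E; rewrite -(nth_index u (s := enum G) (x := u)) ?mem_enum //.
by rewrite -/(rank u) E nth_index ?mem_enum.
Qed.

Lemma rank_cat p v q : enum G = p ++ v :: q -> rank v = size p.
Proof.
move=> E; have := enum_uniq G; rewrite /rank E cat_uniq => /and3P[_ /hasPn/= + _].
move=> /(_ v (mem_head _ _)) vp.
by rewrite index_cat (negbTE vp) /= eqxx addn0.
Qed.

(** The invariant refers to the prefix [p] of [enum G] already visited. By [ext] it depends only on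
    registers below [i], since the two loop registers change between rounds. A round costs 12 beyond
    its body, start and final test cost 8; both are rounded up to 20. The final value [1 + n * n] of
    register [i.+1] is passed on because [recognize] uses it. *)
Lemma runs_loop i body (f : G -> nat) s T
    (I : seq G -> (nat -> nat) -> (nat -> nat) -> Prop) (Q : state -> Prop) :
  1 < i -> reg s 1 = n ->
  (forall p r1 r2 m, (forall j, j < i -> r1 j = r2 j) -> I p r1 m -> I p r2 m) ->
  I [::] (reg s) (Defs.mem s) ->
  (forall p v q s1, enum G = p ++ v :: q -> I p (reg s1) (Defs.mem s1) ->
     reg s1 1 = n -> reg s1 i = rank v -> reg s1 i.+1 = row v ->
     runs body s1 (f v) (fun s2 =>
       [/\ reg s2 1 = n, reg s2 i = rank v, reg s2 i.+1 = row v
         & I (rcons p v) (reg s2) (Defs.mem s2)])) ->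
  (forall s1, I (enum G) (reg s1) (Defs.mem s1) -> reg s1 1 = n ->
     reg s1 i.+1 = 1 + n * n -> Q s1) ->
  20 + \sum_v (f v + 20) <= T ->
  runs (Loop i body) s T Q.
Proof.
move=> i1 sn ext I0 step fin lT.
have main q : forall p s1, enum G = p ++ q -> I p (reg s1) (Defs.mem s1) ->
    reg s1 1 = n -> reg s1 i = size p -> reg s1 i.+1 = 1 + size p * n ->
    runs (While (Defs.Sub (Reg 1) (Reg i))
      (Seq body (Seq (Assign i (Add (Reg i) (Cst 1)))
                     (Assign i.+1 (Add (Reg i.+1) (Reg 1)))))) s1
      (5 + \sum_(v <- q) (f v + 20)) Q.
  have i1' : (1 == i) = false by lia.
  have i1'' : (1 == i.+1) = false by lia.
  have ii : (i == i.+1) = false by lia.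
  have ii' : (i.+1 == i) = false by lia.
  elim: q => [|v q IH] p s1 Ep Ip s1n s1i s1b.
    rewrite cats0 in Ep; have sp : size p = n by rewrite -Ep -cardE.
    exists s1, (cost (Defs.Sub (Reg 1) (Reg i))).+1; split=> //.
      by apply: ExecWhileFalse; rewrite /= s1n s1i sp subnn.
    by apply: fin; rewrite ?Ep // s1b sp.
  have rv := rank_cat Ep.
  have vn : size p < n by rewrite -rv rank_lt.
  have [||s2 [t2 [e2 l2 [s2n s2i s2b I2]]]] := step p v q s1 Ep Ip s1n.
  - by rewrite s1i rv.
  - by rewrite s1b /row rv.
  set r3 := upd (upd (reg s2) i (rank v).+1) i.+1 (row v + n).
  have [|||||s3 [t3 [e3 l3 q3]]] := IH (rcons p v) (State r3 (Defs.mem s2)).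
  - by rewrite cat_rcons.
  - apply: ext I2 => j ji /=; rewrite /r3 /upd.
    by rewrite !ifF //; lia.
  - by rewrite /= /r3 /upd i1' i1''.
  - by rewrite /= /r3 /upd ii eqxx size_rcons rv.
  - by rewrite /= /r3 /upd eqxx size_rcons /row rv; lia.
  exists s3, (cost (Defs.Sub (Reg 1) (Reg i)) + (t2 + (4 + 4)) + t3).+1; split=> //.
    apply: ExecWhileTrue e3; first by rewrite /= s1n s1i; lia.
    apply: ExecSeq e2 _.
    have -> : State r3 (Defs.mem s2) =
      let s' := State (upd (reg s2) i (eval s2 (Add (Reg i) (Cst 1)))) (Defs.mem s2) in
      State (upd (reg s') i.+1 (eval s' (Add (Reg i.+1) (Reg 1)))) (Defs.mem s').
      have E1 k : upd (reg s2) i k i.+1 = reg s2 i.+1 by rewrite /upd ii'.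
      have E2 k : upd (reg s2) i k 1 = reg s2 1 by rewrite /upd i1'.
      by rewrite /= E1 E2 s2n s2i s2b addn1.
    by apply: ExecSeq; constructor.
  by rewrite big_cons /=; lia.
have ext' j r1 r2 : j < i -> r2 j = upd (upd r1 i 0) i.+1 1 j -> r1 j = r2 j.
  by move=> ji ->; rewrite /upd !ifF //; lia.
apply: (@runs_seq 2 (2 + (5 + \sum_(v <- enum G) (f v + 20)))).
- by apply: runs_assign; [|exact: erefl].
- move=> _ <-; apply: (@runs_seq 2 (5 + \sum_(v <- enum G) (f v + 20))) => //.
    by apply: runs_assign; [|exact: erefl].
  move=> _ <-; apply: (main _ [::]) => //=.
  + by apply: ext I0 => j ji; apply: ext' ji _.
  + by rewrite /upd !ifF //; lia.
  + by rewrite /upd eqxx ifF //; lia.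
  + by rewrite /upd eqxx; lia.
have -> : \sum_(v <- enum G) (f v + 20) = \sum_v (f v + 20) by rewrite big_enum.
by move: lT; lia.
Qed.

End Machine.

(** * The recognition program *)

(* Registers: [0] is the output, [1] the number [n] of nodes; [2] and [3] hold
   the addresses of two arrays of length [n] behind the adjacency matrix, which
   record the nodes separated from [y] and the marks of the current search. The
   loops over [x], [y], [a], [b] use [4], [6], [8], [10], and [14], [15] hold
   the node being processed by the search and the address of its row. *)
Definition Adj i j := Read (Add (Reg i.+1) (Reg j)).
Definition Sep i := Add (Reg 2) (Reg i).
Definition Mark i := Add (Reg 3) (Reg i).

Definition select_active :=
  Loop 16 (If (Defs.Sub (Read (Mark 16)) (Cst 1))
              (Seq (Assign 14 (Reg 16)) (Assign 15 (Reg 17))) Skip).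

Definition activate_neighbors :=
  Loop 16 (If (Defs.Sub (Adj 14 16) (Read (Mark 16)))
              (Write (Mark 16) (Cst 2)) Skip).

(* Marks: [0] unseen, [2] seen, [1] seen and processed, or blocked. *)
Definition round :=
  Seq (Assign 14 (Reg 6)) (Seq (Assign 15 (Reg 7)) (Seq select_active
    (Seq (Write (Mark 14) (Cst 1)) activate_neighbors))).

(** [y] is marked last, which undoes a block set by [a] or [b] being [y], as [blocked] requires.
    [Loop 12] serves as a counter: n rounds suffice, since a node leaves the active state once and
    for all. *)
Definition search :=
  Seq (Loop 16 (Write (Mark 16) (Cst 0)))
    (Seq (Write (Mark 4) (Cst 1)) (Seq (Write (Mark 8) (Cst 1))
      (Seq (Write (Mark 10) (Cst 1)) (Seq (Write (Mark 6) (Cst 2))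
        (Loop 12 round))))).

Definition record :=
  Loop 16 (If (Read (Mark 16)) Skip (Write (Sep 16) (Cst 1))).

(** Subtraction is truncated, so the two differences add up to the distance of the ranks, and 1
    minus it tests equality. The condition says that [a] and [b] are adjacent or equal. *)
Definition try_pair :=
  If (Add (Adj 8 10) (Defs.Sub (Cst 1)
       (Add (Defs.Sub (Reg 8) (Reg 10)) (Defs.Sub (Reg 10) (Reg 8)))))
     (Seq search record) Skip.

Definition check_neighbors :=
  Loop 16 (If (Defs.Sub (Adj 4 16) (Read (Sep 16))) (Assign 0 (Cst 0)) Skip).

(** Recording [y] as separated from itself exempts the case z = y from the final check. *)
Definition try_arc :=
  If (Adj 4 6)
     (Seq (Loop 16 (Write (Sep 16) (Cst 0))) (Seq (Write (Sep 6) (Cst 1))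
       (Seq (Loop 8 (Loop 10 try_pair)) check_neighbors)))
     Skip.

(** The empty loop [Loop 4 Skip] computes [1 + n * n], the first address behind the matrix, by
    repeated addition. With three nodes the answer stays YES, because a rim and its center need
    four. *)
Definition recognize :=
  Seq (Assign 0 (Cst 1)) (Seq (Assign 1 (Read (Cst 0)))
    (If (Defs.Sub (Reg 1) (Cst 3))
        (Seq (Loop 4 Skip) (Seq (Assign 2 (Reg 5))
          (Seq (Assign 3 (Add (Reg 2) (Reg 1))) (Loop 4 (Loop 6 try_arc)))))
        Skip)).

(** * Specifications of the subprograms *)

Section Specification.
Variable G : sgraph.
Implicit Types (s : state) (x y z u v w a b : G) (p q : seq G) (f sp mk : G -> nat).
Let n := #|G|.
Let base := 1 + n * n.

Definition set_at f v k : G -> nat := fun w => if w == v then k else f w.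

Definition memory (m : nat -> nat) sp mk : Prop :=
  [/\ forall u v, m (row u + rank v) = edge u v,
      forall v, m (base + rank v) = sp v
    & forall v, m (base + n + rank v) = mk v].

Lemma row_lt u v : row u + rank v < base.
Proof.
have ru := rank_lt u; have rv := rank_lt v.
rewrite /base /row -/n in ru rv *.
have : (rank u).+1 * n <= n * n by rewrite leq_mul2r ru orbT.
by rewrite mulSn; lia.
Qed.

Lemma memory_sep m sp mk v k : memory m sp mk ->
  memory (upd m (base + rank v) k) (set_at sp v k) mk.
Proof.
case=> A S M; split=> [u w|w|w]; rewrite /upd.
- by rewrite ifF //; have := row_lt u w; lia.
- by rewrite eqn_add2l (inj_eq (@rank_inj G)) S.
by rewrite ifF //; have := rank_lt v; rewrite -/n; lia.
Qed.

Lemma memory_mark m sp mk v k : memory m sp mk ->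
  memory (upd m (base + n + rank v) k) sp (set_at mk v k).
Proof.
case=> A S M; split=> [u w|w|w]; rewrite /upd.
- by rewrite ifF //; have := row_lt u w; lia.
- by rewrite ifF //; have := rank_lt w; rewrite -/n; lia.
by rewrite eqn_add2l (inj_eq (@rank_inj G)) M.
Qed.

Lemma eq_memory m sp sp' mk mk' : memory m sp mk -> sp =1 sp' -> mk =1 mk' ->
  memory m sp' mk'.
Proof. by case=> A S M E1 E2; split=> // v; rewrite -?E1 -?E2. Qed.

Definition agree L (r r' : nat -> nat) := forall j, j < L -> r' j = r j.

Definition layout (r : nat -> nat) := [/\ r 1 = n, r 2 = base & r 3 = base + n].

Definition node_at (r : nat -> nat) i v := r i = rank v /\ r i.+1 = row v.

Lemma agree_layout L r r' : 3 < L -> agree L r r' -> layout r -> layout r'.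
Proof. by move=> L3 E [r1 r2 r3]; split; rewrite E //; lia. Qed.

Lemma agree_node L r r' i v : i.+1 < L -> agree L r r' ->
  node_at r i v -> node_at r' i v.
Proof. by move=> iL E [r1 r2]; split; rewrite E //; lia. Qed.

Lemma agreeW L L' r r' : L <= L' -> agree L' r r' -> agree L r r'.
Proof. by move=> LL E j jL; apply: E; lia. Qed.

Lemma agree_trans L r r' r'' : agree L r r' -> agree L r' r'' -> agree L r r''.
Proof. by move=> E1 E2 j jL; rewrite E2 // E1. Qed.

Lemma sum_const_nat (c : nat) : \sum_(v : G) c = n * c.
Proof. by rewrite sum_nat_const. Qed.

(** The form of [runs_loop] for bodies whose lasting effect is confined to memory. *)
Lemma runs_node_loop i body f s T (J : seq G -> (nat -> nat) -> Prop)
    (Q : state -> Prop) :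
  3 < i -> layout (reg s) -> J [::] (Defs.mem s) ->
  (forall p v q s1, enum G = p ++ v :: q -> J p (Defs.mem s1) ->
     agree i (reg s) (reg s1) -> layout (reg s1) -> node_at (reg s1) i v ->
     runs body s1 (f v) (fun s2 =>
       agree i.+2 (reg s1) (reg s2) /\ J (rcons p v) (Defs.mem s2))) ->
  (forall s1, J (enum G) (Defs.mem s1) -> agree i (reg s) (reg s1) -> Q s1) ->
  20 + \sum_v (f v + 20) <= T ->
  runs (Loop i body) s T Q.
Proof.
move=> i3 lay J0 step fin lT.
apply: (@runs_loop G i body f s T
  (fun p r m => agree i (reg s) r /\ J p m)) => //.
- by lia.
- by case: lay.
- by move=> p r1 r2 m E [E1 Jp]; split=> // j ji; rewrite -E // E1.
- move=> p v q s1 Ep [E Jp] s1n s1i s1b.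
  have lay1 : layout (reg s1) by apply: agree_layout E lay.
  apply: runs_le (step p v q s1 Ep Jp E lay1 (conj s1i s1b)) (leqnn _) _.
  move=> s2 [E2 J2]; have [r1 _ _] := lay1.
  split; rewrite ?E2 //; try lia.
  by split=> // j ji; rewrite E2 ?E //; lia.
by move=> s1 [E Jp] _ _; apply: fin.
Qed.

Lemma eval_mark s i v : layout (reg s) -> node_at (reg s) i v ->
  eval s (Mark i) = base + n + rank v.
Proof. by case=> _ _ r3 [ri _]; rewrite /= r3 ri. Qed.

Lemma eval_sep s i v : layout (reg s) -> node_at (reg s) i v ->
  eval s (Sep i) = base + rank v.
Proof. by case=> _ r2 _ [ri _]; rewrite /= r2 ri. Qed.

Lemma eval_read_mark s sp mk i v : layout (reg s) -> node_at (reg s) i v ->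
  memory (Defs.mem s) sp mk -> eval s (Read (Mark i)) = mk v.
Proof. by move=> lay nd [_ _ M]; rewrite -M -(eval_mark lay nd). Qed.

Lemma eval_read_sep s sp mk i v : layout (reg s) -> node_at (reg s) i v ->
  memory (Defs.mem s) sp mk -> eval s (Read (Sep i)) = sp v.
Proof. by move=> lay nd [_ S _]; rewrite -S -(eval_sep lay nd). Qed.

Lemma eval_adj s sp mk i j u v : node_at (reg s) i u -> node_at (reg s) j v ->
  memory (Defs.mem s) sp mk -> eval s (Adj i j) = edge u v.
Proof. by case=> _ ri [rj _] [A _ _]; rewrite /= ri rj A. Qed.

Lemma clear_marks_spec s sp mk T (Q : state -> Prop) :
  layout (reg s) -> memory (Defs.mem s) sp mk -> 20 + n * 30 <= T ->
  (forall s1, memory (Defs.mem s1) sp (fun=> 0) -> agree 16 (reg s) (reg s1) -> Q s1) ->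
  runs (Loop 16 (Write (Mark 16) (Cst 0))) s T Q.
Proof.
move=> lay M lT fin.
apply: (@runs_node_loop 16 _ (fun=> 10) s T
  (fun p m => memory m sp (fun v => if v \in p then 0 else mk v))) => //.
- move=> p v q s1 _ Jp _ lay1 nd; apply: runs_write => //; split=> //=.
  rewrite -[reg s1 3 + _]/(eval s1 (Mark 16)) (eval_mark lay1 nd).
  apply: eq_memory (memory_mark v 0 Jp) _ _ => // w.
  by rewrite /set_at mem_rcons inE; case: (w == v).
- move=> s1 J1; apply: fin; apply: eq_memory J1 _ _ => // v.
  by rewrite mem_enum.
by rewrite sum_const_nat.
Qed.

Lemma clear_sep_spec s sp mk T (Q : state -> Prop) :
  layout (reg s) -> memory (Defs.mem s) sp mk -> 20 + n * 30 <= T ->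
  (forall s1, memory (Defs.mem s1) (fun=> 0) mk -> agree 16 (reg s) (reg s1) -> Q s1) ->
  runs (Loop 16 (Write (Sep 16) (Cst 0))) s T Q.
Proof.
move=> lay M lT fin.
apply: (@runs_node_loop 16 _ (fun=> 10) s T
  (fun p m => memory m (fun v => if v \in p then 0 else sp v) mk)) => //.
- move=> p v q s1 _ Jp _ lay1 nd; apply: runs_write => //; split=> //=.
  rewrite -[reg s1 2 + _]/(eval s1 (Sep 16)) (eval_sep lay1 nd).
  apply: eq_memory (memory_sep v 0 Jp) _ _ => // w.
  by rewrite /set_at mem_rcons inE; case: (w == v).
- move=> s1 J1; apply: fin; apply: eq_memory J1 _ _ => // v.
  by rewrite mem_enum.
by rewrite sum_const_nat.
Qed.

Lemma select_active_spec s sp mk y T (Q : state -> Prop) :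
  layout (reg s) -> memory (Defs.mem s) sp mk -> node_at (reg s) 14 y ->
  20 + n * 40 <= T ->
  (forall s1 u, memory (Defs.mem s1) sp mk -> agree 14 (reg s) (reg s1) ->
     node_at (reg s1) 14 u -> u = y \/ 1 < mk u ->
     (forall v, 1 < mk v -> 1 < mk u) -> Q s1) ->
  runs select_active s T Q.
Proof.
move=> lay M ny lT fin.
apply: (@runs_loop G 16 _ (fun=> 20) s T
  (fun p r m => [/\ agree 14 (reg s) r, memory m sp mk
     & exists u, [/\ node_at r 14 u, u = y \/ 1 < mk u
       & forall v, v \in p -> 1 < mk v -> 1 < mk u]])) => //.
- by case: lay.
- move=> p r1 r2 m E [E1 Mm [u [[n1 n2] uy Hu]]]; split=> //.
    by move=> j ji; rewrite -E ?E1 //; lia.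
  by exists u; split=> //; split; rewrite -E.
- by split=> //; exists y; split=> //; left.
- move=> p v q s1 _ [E1 M1 [u [nu uy Hu]]] s1n s1i s1b.
  have lay1 : layout (reg s1) by apply: agree_layout E1 lay.
  have nv : node_at (reg s1) 16 v by [].
  apply: (@runs_if 10) => //.
    rewrite -[eval _ _]/(eval s1 (Read (Mark 16)) - 1) (eval_read_mark lay1 nv M1).
    move=> vact; have {}vact : 1 < mk v by lia.
    apply: (@runs_seq 4 4) => //; first by apply: runs_assign; [|exact: erefl].
    move=> _ <-; apply: runs_assign => //=; split; rewrite /upd //=.
    split=> //; first by move=> j j14; rewrite -E1 // !ifF //; lia.
    by exists v; split=> //; right.
  rewrite -[eval _ _]/(eval s1 (Read (Mark 16)) - 1) (eval_read_mark lay1 nv M1).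
  move=> vna; apply: runs_skip => //; split=> //; split=> //; exists u; split=> //.
  by move=> w; rewrite mem_rcons inE => /predU1P[->|]; [lia|apply: Hu].
- move=> s1 [E1 M1 [u [nu uy Hu]]] _ _; apply: (fin s1 u) => //.
  by move=> v; apply: Hu; rewrite mem_enum.
by rewrite sum_const_nat.
Qed.

Lemma activate_neighbors_spec s sp mk u T (Q : state -> Prop) :
  layout (reg s) -> memory (Defs.mem s) sp mk -> node_at (reg s) 14 u ->
  20 + n * 40 <= T ->
  (forall s1, memory (Defs.mem s1) sp
       (fun v => if edge u v && (mk v == 0) then 2 else mk v) ->
     agree 16 (reg s) (reg s1) -> Q s1) ->
  runs activate_neighbors s T Q.
Proof.
move=> lay M nu lT fin.
apply: (@runs_node_loop 16 _ (fun=> 20) s T (fun p m => memory m sp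
  (fun v => if [&& v \in p, edge u v & mk v == 0] then 2 else mk v))) => //.
- move=> p v q s1 Ep Jp E lay1 nv.
  (* As [v] has not been visited yet, its mark is still the one from before the loop. *)
  have vp : v \notin p.
    have := enum_uniq G; rewrite Ep cat_uniq => /and3P[_ /hasPn/= + _].
    by move/(_ v (mem_head _ _)).
  have nu1 : node_at (reg s1) 14 u by apply: agree_node E nu.
  have eE : eval s1 (Defs.Sub (Adj 14 16) (Read (Mark 16))) = edge u v - mk v.
    rewrite -[LHS]/(eval s1 (Adj 14 16) - eval s1 (Read (Mark 16))).
    by rewrite (eval_adj nu1 nv Jp) (eval_read_mark lay1 nv Jp) (negbTE vp).
  apply: (@runs_if 10) => //; rewrite eE => ec.
    apply: runs_write => //; split=> //=.
    rewrite -[reg s1 3 + _]/(eval s1 (Mark 16)) (eval_mark lay1 nv).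
    apply: eq_memory (memory_mark v 2 Jp) _ _ => // w.
    rewrite /set_at mem_rcons inE; case: (eqVneq w v) => [->|] //=.
    by move: ec; case: (edge u v) => //=; case: (mk v).
  apply: runs_skip => //; split=> //; apply: eq_memory Jp _ _ => // w.
  rewrite mem_rcons inE; case: (eqVneq w v) => [->|] //=; move: ec.
  by rewrite ?(negbTE vp); case: (edge u v) => //=; case: (mk v).
- move=> s1 J1; apply: fin; apply: eq_memory J1 _ _ => // v.
  by rewrite mem_enum.
by rewrite sum_const_nat.
Qed.

Definition next_marks mk u v :=
  let mk1 := set_at mk u 1 in if edge u v && (mk1 v == 0) then 2 else mk1 v.

(** The choice of [u] is initialized with [y] and overwritten by active nodes. If there is none, [y]
    is processed once more, so a finished search needs no separate test. *)
Lemma round_spec s sp mk y T (Q : state -> Prop) :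
  layout (reg s) -> memory (Defs.mem s) sp mk -> node_at (reg s) 6 y ->
  60 + n * 80 <= T ->
  (forall s1 u, memory (Defs.mem s1) sp (next_marks mk u) ->
     agree 14 (reg s) (reg s1) -> u = y \/ 1 < mk u ->
     (forall v, 1 < mk v -> 1 < mk u) -> Q s1) ->
  runs round s T Q.
Proof.
move=> lay M [y1 y2] lT fin.
apply: (@runs_seq 2 (50 + n * 80)) => [||]; last by lia.
  by apply: runs_assign; [|exact: erefl].
move=> _ <-; apply: (@runs_seq 2 (48 + n * 80)) => [||]; last by lia.
  by apply: runs_assign; [|exact: erefl].
move=> _ <-; set s1 := State _ _.
have E1 : agree 14 (reg s) (reg s1).
  by move=> j j14; rewrite /s1 /upd /= !ifF //; lia.
have lay1 : layout (reg s1) by apply: agree_layout E1 lay.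
have ny : node_at (reg s1) 14 y by split.
apply: (@runs_seq (20 + n * 40) (26 + n * 40)) => [||]; last by lia.
  apply: (select_active_spec (sp := sp) (mk := mk) (y := y)
    (Q := fun s2 => exists u, [/\ memory (Defs.mem s2) sp mk,
      agree 14 (reg s1) (reg s2), node_at (reg s2) 14 u, u = y \/ 1 < mk u
      & forall v, 1 < mk v -> 1 < mk u])) => //.
  by move=> s2 u M2 E2 nu uy Hu; exists u.
move=> s2 [u [M2 E2 nu uy Hu]].
have lay2 : layout (reg s2) by apply: agree_layout E2 lay1.
apply: (@runs_seq 5 (20 + n * 40)) => [||]; last by lia.
  by apply: runs_write; [|exact: erefl].
move=> _ <-; rewrite (eval_mark lay2 nu); set s3 := State _ _.
have M3 : memory (Defs.mem s3) sp (set_at mk u 1) by apply: memory_mark.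
apply: (activate_neighbors_spec (s := s3) lay2 M3 nu) => // s4 M4 E4.
apply: (fin s4 u) => //.
by apply: agree_trans E1 (agree_trans E2 (agreeW _ E4)).
Qed.

(** * Correctness of the graph search *)

Section Search.
Variables (y : G) (B : pred G).
Hypothesis nBy : ~~ B y.
Let reach := connect (wedge (fun v => ~~ B v)) y.

(* After [i] rounds either no node is active or [i] nodes have mark [1]. *)
Definition search_inv i mk : Prop :=
  [/\ forall v, B v -> mk v = 1,
      mk y != 0,
      forall v, mk v != 0 -> ~~ B v -> reach v,
      forall v w, mk v = 1 -> ~~ B v -> edge v w -> mk w != 0
    & (forall v, mk v <= 1) \/ i <= #|[pred v | mk v == 1]|].

(** If some node is active, so is [u]; its mark drops to 1, and nodes with mark 1 keep it, so their
    number grows. If none is active, [u] is [y] with mark 1, its neighbors have all been seen, and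
    nothing becomes active. *)
Lemma search_inv_next i mk u : search_inv i mk -> u = y \/ 1 < mk u ->
  (forall v, 1 < mk v -> 1 < mk u) -> search_inv i.+1 (next_marks mk u).
Proof.
case=> JB Jy Jr Je Jc uy Hu.
have u0 : mk u != 0 by case: uy => [->//|]; lia.
have nBu : ~~ B u.
  by case: uy => [->//|]; apply: contraTN => /JB->.
have keep v : mk v != 0 -> next_marks mk u v != 0.
  by move=> v0; rewrite /next_marks /set_at; case: (v == u) => //=; rewrite ?(negbTE v0) ?andbF.
have keep1 v : mk v = 1 -> next_marks mk u v = 1.
  by move=> v1; rewrite /next_marks /set_at v1; case: (v == u); rewrite ?andbF.
have nu : next_marks mk u u = 1 by rewrite /next_marks /set_at eqxx andbF.
have adj w : edge u w -> next_marks mk u w != 0.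
  by rewrite /next_marks => -> /=; case: ifP => // /negbT.
split.
- by move=> v /JB; apply: keep1.
- exact: keep.
- move=> v nv nBv; have [v0|] := eqVneq (mk v) 0; last by move=> v0; apply: Jr.
  have ru : reach u by apply: Jr.
  have [->//|vu] := eqVneq v u.
  apply: connect_trans ru _; apply: connect1; rewrite /= nBu nBv !andbT.
  move: nv; rewrite /next_marks /set_at (negbTE vu) v0 eqxx andbT.
  by case: (edge u v).
- move=> v w nv nBv e; have [vu|vu] := eqVneq v u; first by rewrite vu in e; apply: adj.
  apply: keep; apply: (Je v) => //.
  by move: nv; rewrite /next_marks /set_at (negbTE vu); case: ifP.
have [/existsP[v v2]|no2] := boolP [exists v, 1 < mk v].
  right; have u2 := Hu v v2.
  have uN : u \notin [pred v | mk v == 1] by rewrite inE; lia.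
  have Jc' : i <= #|[pred v | mk v == 1]| by case: Jc => // /(_ u); lia.
  apply: leq_ltn_trans Jc' _; apply: proper_card; apply/properP; split.
    by apply/subsetP=> w; rewrite !inE => /eqP/keep1->.
  by exists u; rewrite // inE nu.
left=> v; have le1 w : mk w <= 1.
  by rewrite leqNgt; apply: contra no2 => w2; apply/existsP; exists w.
have u1 : mk u = 1 by have := le1 u; lia.
rewrite /next_marks /set_at; case: (v == u); rewrite ?andbF //.
by case: ifP => // /andP[e v0]; have := Je u v u1 nBu e; rewrite v0.
Qed.

(** If n nodes have mark 1, these are all nodes, so in either alternative none is active. Then the
    marked unblocked nodes are closed under unblocked neighbors and contain everything reachable. *)
Lemma search_inv_end mk v : search_inv n mk ->
  (mk v == 0) = ~~ B v && ~~ reach v.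
Proof.
case=> JB Jy Jr Je Jc.
have le1 w : mk w <= 1.
  case: Jc => // cn; have : w \in [pred v | mk v == 1].
    rewrite (_ : (w \in _) = (w \in predT)) //; apply: (subset_cardP _ _ w).
      by apply/eqP; rewrite eqn_leq max_card cardT -cardE.
    by apply/subsetP.
  by rewrite inE => /eqP->.
have mk1 w : mk w != 0 -> mk w = 1 by have := le1 w; lia.
have cl w : reach w -> mk w != 0.
  suff H p d : ~~ B d -> mk d != 0 ->
      path (wedge (fun v => ~~ B v)) d p -> mk (last d p) != 0.
    by case/connectP=> p + ->; apply: H.
  elim: p d => //= c p IH d nBd d0 /andP[/and3P[e _ nBc]]; apply: IH => //.
  by apply: Je (mk1 _ d0) nBd e.
apply/idP/andP => [/eqP v0|[nBv nr]].
  by split; [apply: contraPN v0 => /JB->|apply: contraPN v0 => /cl/eqP].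
by apply: contraNT nr => v0; apply: Jr.
Qed.
End Search.

Lemma search_spec s sp mk x y a b T (Q : state -> Prop) :
  layout (reg s) -> memory (Defs.mem s) sp mk ->
  node_at (reg s) 4 x -> node_at (reg s) 6 y ->
  node_at (reg s) 8 a -> node_at (reg s) 10 b ->
  100 + n * 110 + n * n * 80 <= T ->
  (forall s1 mk1, memory (Defs.mem s1) sp mk1 -> agree 12 (reg s) (reg s1) ->
     (forall v, (mk1 v == 0) = ~~ blocked x y a b v &&
        ~~ connect (wedge (fun v => ~~ blocked x y a b v)) y v) -> Q s1) ->
  runs search s T Q.
Proof.
move=> lay M nx ny na nb lT fin.
apply: (@runs_seq (20 + n * 30) (60 + n * 80 + n * n * 80)) => [||]; last by lia.
  apply: (clear_marks_spec lay M _ (Q := fun s1 =>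
    memory (Defs.mem s1) sp (fun=> 0) /\ agree 16 (reg s) (reg s1))) => //.
move=> s1 [M1 E1].
have lay1 : layout (reg s1) by apply: agree_layout E1 lay.
have {}nx : node_at (reg s1) 4 x by apply: agree_node E1 nx.
have {}ny : node_at (reg s1) 6 y by apply: agree_node E1 ny.
have {}na : node_at (reg s1) 8 a by apply: agree_node E1 na.
have {}nb : node_at (reg s1) 10 b by apply: agree_node E1 nb.
apply: (@runs_seq 5 (55 + n * 80 + n * n * 80)) => [||]; last by lia.
  by apply: runs_write; [|exact: erefl].
move=> _ <-; rewrite (eval_mark lay1 nx); set s2 := State _ _.
have M2 := memory_mark x 1 M1.
apply: (@runs_seq 5 (50 + n * 80 + n * n * 80)) => [||]; last by lia.
  by apply: runs_write; [|exact: erefl].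
move=> _ <-; rewrite (eval_mark (s := s2) lay1 na); set s3 := State _ _.
have M3 := memory_mark a 1 M2.
apply: (@runs_seq 5 (45 + n * 80 + n * n * 80)) => [||]; last by lia.
  by apply: runs_write; [|exact: erefl].
move=> _ <-; rewrite (eval_mark (s := s3) lay1 nb); set s4 := State _ _.
have M4 := memory_mark b 1 M3.
apply: (@runs_seq 5 (40 + n * 80 + n * n * 80)) => [||]; last by lia.
  by apply: runs_write; [|exact: erefl].
move=> _ <-; rewrite (eval_mark (s := s4) lay1 ny); set s5 := State _ _.
have := memory_mark y 2 M4; set mk5 := set_at _ y 2 => M5.
have nBy : ~~ blocked x y a b y by rewrite /blocked eqxx andbF.
have inv0 : search_inv y (blocked x y a b) 0 mk5.
  have mk5E v : mk5 v = if v == y then 2 else nat_of_bool (v \in [:: x; a; b]).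
    rewrite /mk5 /set_at !inE; case: (v == y) => //; case: (v == b); rewrite ?orbT //.
    by case: (v == a); rewrite ?orbT //; case: (v == x).
  split; last by right.
  - by move=> v /andP[vB vy]; rewrite mk5E (negbTE vy) vB.
  - by rewrite mk5E eqxx.
  - move=> v; rewrite mk5E; case: (eqVneq v y) => [->|vy]; first by move=> _ _; apply: connect0.
    by rewrite /blocked vy andbT; case: (v \in _).
  move=> v w; rewrite mk5E; case: (eqVneq v y) => // vy.
  by rewrite /blocked vy andbT; case: (v \in _).
apply: (@runs_node_loop 12 _ (fun=> 60 + n * 80) _ _ (fun p m =>
  exists mk', memory m sp mk' /\ search_inv y (blocked x y a b) (size p) mk')) => //.
- by exists mk5.
- move=> p v q s6 _ [mk6 [M6 J6]] E6 lay6 _.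
  have ny6 : node_at (reg s6) 6 y by apply: agree_node E6 ny.
  apply: (round_spec lay6 M6 ny6) => // s7 u M7 E7 uy Hu; split=> //.
  exists (next_marks mk6 u); split=> //.
  by rewrite size_rcons; apply: search_inv_next.
- move=> s6 [mk6 [M6 J6]] E6; apply: (fin s6 mk6) => //.
    by apply: agree_trans (agreeW _ E1) E6.
  by move=> v; apply: search_inv_end => //; rewrite /n cardE.
by rewrite sum_const_nat; lia.
Qed.

Lemma record_spec s sp mk T (Q : state -> Prop) :
  layout (reg s) -> memory (Defs.mem s) sp mk -> 20 + n * 35 <= T ->
  (forall s1, memory (Defs.mem s1) (fun v => if mk v == 0 then 1 else sp v) mk ->
     agree 16 (reg s) (reg s1) -> Q s1) ->
  runs record s T Q.
Proof.
move=> lay M lT fin.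
apply: (@runs_node_loop 16 _ (fun=> 15) s T (fun p m => memory m
  (fun v => if (v \in p) && (mk v == 0) then 1 else sp v) mk)) => //.
- move=> p v q s1 _ Jp _ lay1 nd; apply: (@runs_if 6) => //.
    rewrite (eval_read_mark lay1 nd Jp) => v0; apply: runs_skip => //; split=> //.
    apply: eq_memory Jp _ _ => // w; rewrite mem_rcons inE.
    by have [->|] := eqVneq w v; rewrite //= (negbTE v0) !andbF.
  rewrite (eval_read_mark lay1 nd Jp) => v0; apply: runs_write => //; split=> //=.
  rewrite -[reg s1 2 + _]/(eval s1 (Sep 16)) (eval_sep lay1 nd).
  apply: eq_memory (memory_sep v 1 Jp) _ _ => // w.
  by rewrite /set_at mem_rcons inE; have [->|] := eqVneq w v; rewrite //= v0 eqxx.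
- move=> s1 J1; apply: fin; apply: eq_memory J1 _ _ => // v.
  by rewrite mem_enum.
by rewrite sum_const_nat.
Qed.

Definition pair_separates x y a b z : bool :=
  [&& (a == b) || edge a b, ~~ blocked x y a b z
    & ~~ connect (wedge (fun v => ~~ blocked x y a b v)) y z].

Let search_time := 200 + n * 150 + n * n * 80.
(** The boolean factor charges a search only to pairs that pass the test, so that summation counts
    at most n + 2m searches instead of [n * n]. *)
Let pair_time a b := 30 + ((a == b) || edge a b) * search_time.

Lemma try_pair_spec s sp mk x y a b (Q : state -> Prop) :
  layout (reg s) -> memory (Defs.mem s) sp mk ->
  node_at (reg s) 4 x -> node_at (reg s) 6 y ->
  node_at (reg s) 8 a -> node_at (reg s) 10 b ->
  (forall s1 sp1 mk1, memory (Defs.mem s1) sp1 mk1 -> agree 12 (reg s) (reg s1) ->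
     (forall v, (sp1 v != 0) = (sp v != 0) || pair_separates x y a b v) -> Q s1) ->
  runs try_pair s (pair_time a b) Q.
Proof.
move=> lay M nx ny na nb fin.
apply: (@runs_if (10 + ((a == b) || edge a b) * search_time));
  rewrite -1?[eval _ _]/(eval s (Adj 8 10) +
    (1 - ((reg s 8 - reg s 10) + (reg s 10 - reg s 8)))).
- by rewrite /pair_time /=; lia.
- rewrite (eval_adj na nb M); case: (na) (nb) => -> _ [-> _] good.
  have {}good : (a == b) || edge a b.
    move: good; case: (edge a b) => //=; rewrite ?orbT // orbF => good.
    by apply/eqP/rank_inj; lia.
  rewrite good mul1n.
  apply: (@runs_seq (100 + n * 110 + n * n * 80) (20 + n * 35)) => [||].
  + apply: (search_spec lay M nx ny na nb (leqnn _) (Q := fun s1 =>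
      exists mk1, [/\ memory (Defs.mem s1) sp mk1, agree 12 (reg s) (reg s1)
      & forall v, (mk1 v == 0) = ~~ blocked x y a b v &&
        ~~ connect (wedge (fun v => ~~ blocked x y a b v)) y v])).
    by move=> s1 mk1 M1 E1 H1; exists mk1.
  + move=> s1 [mk1 [M1 E1 H1]].
    have lay1 : layout (reg s1) by apply: agree_layout E1 lay.
    apply: (record_spec lay1 M1) => // s2 M2 E2; apply: fin M2 _ _.
      by apply: agree_trans E1 (agreeW _ E2).
    move=> v; rewrite /pair_separates good /= -H1.
    by case: (mk1 v == 0); rewrite ?orbT ?orbF.
  by rewrite /search_time; lia.
rewrite (eval_adj na nb M); case: (na) (nb) => -> _ [-> _] bad.
have {}bad : ((a == b) || edge a b) = false.
  case: eqVneq bad => [->|_] /=; first by rewrite subnn; lia.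
  by case: (edge a b).
rewrite bad; apply: runs_skip => //; apply: fin M _ _ => // v.
by rewrite /pair_separates bad orbF.
Qed.

Let row_time a := 20 + \sum_b (pair_time a b + 20).
Let pairs_time := 20 + \sum_a (row_time a + 20).

Lemma try_pairs_spec s sp mk x y (Q : state -> Prop) :
  layout (reg s) -> memory (Defs.mem s) sp mk ->
  node_at (reg s) 4 x -> node_at (reg s) 6 y ->
  (forall s1 sp1 mk1, memory (Defs.mem s1) sp1 mk1 -> agree 8 (reg s) (reg s1) ->
     (forall v, (sp1 v != 0) = (sp v != 0) || separated x y v) -> Q s1) ->
  runs (Loop 8 (Loop 10 try_pair)) s pairs_time Q.
Proof.
move=> lay M nx ny fin.
apply: (@runs_node_loop 8 _ row_time s _ (fun p m => exists sp1 mk1,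
  memory m sp1 mk1 /\ forall v, (sp1 v != 0) =
    (sp v != 0) || has (fun a => has (fun b => pair_separates x y a b v) (enum G)) p)) => //.
- by exists sp, mk; split=> // v; rewrite orbF.
- move=> p a q s1 _ [sp1 [mk1 [M1 H1]]] E1 lay1 na.
  have nx1 : node_at (reg s1) 4 x by apply: agree_node E1 nx.
  have ny1 : node_at (reg s1) 6 y by apply: agree_node E1 ny.
  apply: (@runs_node_loop 10 _ (pair_time a) s1 _ (fun p' m => exists sp2 mk2,
    memory m sp2 mk2 /\ forall v, (sp2 v != 0) =
      (sp1 v != 0) || has (fun b => pair_separates x y a b v) p')) => //.
  + by exists sp1, mk1; split=> // v; rewrite orbF.
  + move=> p' b q' s2 _ [sp2 [mk2 [M2 H2]]] E2 lay2 nb.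
    have nx2 : node_at (reg s2) 4 x by apply: agree_node E2 nx1.
    have ny2 : node_at (reg s2) 6 y by apply: agree_node E2 ny1.
    have na2 : node_at (reg s2) 8 a by apply: agree_node E2 na.
    apply: (try_pair_spec lay2 M2 nx2 ny2 na2 nb) => s3 sp3 mk3 M3 E3 H3.
    split=> //; exists sp3, mk3; split=> // v.
    by rewrite H3 H2 has_rcons -orbA [has _ _ || _]orbC.
  move=> s2 [sp2 [mk2 [M2 H2]]] E2; split=> //; exists sp2, mk2; split=> // v.
  by rewrite H2 H1 has_rcons -orbA [has _ p || _]orbC.
move=> s1 [sp1 [mk1 [M1 H1]]] E1; apply: (fin s1 sp1 mk1) => // v.
rewrite H1; congr (_ || _); apply/hasP/existsP => [[a _ /hasP[b _ ab]]|[a /existsP[b ab]]].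
  by exists a; apply/existsP; exists b.
by exists a; rewrite ?mem_enum //; apply/hasP; exists b; rewrite ?mem_enum.
Qed.

(* Register [0], the output, is excluded because the outer loops change it. *)
Definition agree_pos L (r r' : nat -> nat) := forall j, 0 < j < L -> r' j = r j.

Lemma agree_pos_layout L r r' : 3 < L -> agree_pos L r r' -> layout r -> layout r'.
Proof. by move=> L3 E [r1 r2 r3]; split; rewrite E //; lia. Qed.

Lemma agree_pos_node L r r' i v : 0 < i -> i.+1 < L -> agree_pos L r r' ->
  node_at r i v -> node_at r' i v.
Proof. by move=> i0 iL E [r1 r2]; split; rewrite E //; lia. Qed.

(** Register 0 accumulates a conjunction over the nodes: the loop bodies can only lower it from 1 to
    0. *)
Lemma runs_and_loop i body f s (phi : pred G) (M : (nat -> nat) -> Prop) (c : bool)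
    T (Q : state -> Prop) :
  3 < i -> layout (reg s) -> M (Defs.mem s) -> reg s 0 = c ->
  (forall v s1 (d : bool), M (Defs.mem s1) -> agree_pos i (reg s) (reg s1) ->
     layout (reg s1) -> node_at (reg s1) i v -> reg s1 0 = d ->
     runs body s1 (f v) (fun s2 => [/\ agree_pos i.+2 (reg s1) (reg s2),
       M (Defs.mem s2) & reg s2 0 = d && phi v])) ->
  (forall s1, M (Defs.mem s1) -> agree_pos i (reg s) (reg s1) ->
     reg s1 0 = c && [forall v, phi v] -> Q s1) ->
  20 + \sum_v (f v + 20) <= T ->
  runs (Loop i body) s T Q.
Proof.
move=> i3 lay M0 s0 step fin lT.
apply: (@runs_loop G i body f s T (fun p r m =>
  [/\ agree_pos i (reg s) r, M m & r 0 = c && all phi p])) => //.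
- by lia.
- by case: lay.
- move=> p r1 r2 m E [E1 Mm r0]; split=> //; last by rewrite -E //; lia.
  by move=> j ji; rewrite -E ?E1 //; lia.
- by split=> //; rewrite s0 andbT.
- move=> p v q s1 _ [E1 M1 r0] s1n s1i s1b.
  have lay1 : layout (reg s1) by apply: agree_pos_layout E1 lay.
  apply: runs_le (step v s1 _ M1 E1 lay1 (conj s1i s1b) r0) (leqnn _) _.
  move=> s2 [E2 M2 r2]; have r1 j : 0 < j < i.+2 -> reg s2 j = reg s1 j by apply: E2.
  split; try by rewrite r1 //; lia.
  split=> //; first by move=> j ji; rewrite E2 ?E1 //; lia.
  by rewrite r2 all_rcons -andbA [all _ _ && _]andbC.
move=> s1 [E1 M1 r0] _ _; apply: fin => //; rewrite r0; congr (nat_of_bool (_ && _)).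
apply/allP/forallP => H v; first by apply: H; rewrite mem_enum.
by move=> _; apply: H.
Qed.

Lemma check_neighbors_spec s sp mk x (c : bool) T (Q : state -> Prop) :
  layout (reg s) -> memory (Defs.mem s) sp mk -> node_at (reg s) 4 x ->
  reg s 0 = c -> 20 + n * 35 <= T ->
  (forall s1, memory (Defs.mem s1) sp mk -> agree_pos 16 (reg s) (reg s1) ->
     reg s1 0 = c && [forall z, edge x z ==> (sp z != 0)] -> Q s1) ->
  runs check_neighbors s T Q.
Proof.
move=> lay M nx s0 lT fin.
apply: (@runs_and_loop 16 _ (fun=> 15) s (fun z => edge x z ==> (sp z != 0))
  (fun m => memory m sp mk) c) => //; last by rewrite sum_const_nat.
move=> z s1 d M1 E1 lay1 nz s10.
have nx1 : node_at (reg s1) 4 x by apply: agree_pos_node E1 nx.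
have eE : eval s1 (Defs.Sub (Adj 4 16) (Read (Sep 16))) = edge x z - sp z.
  rewrite -[LHS]/(eval s1 (Adj 4 16) - eval s1 (Read (Sep 16))).
  by rewrite (eval_adj nx1 nz M1) (eval_read_sep lay1 nz M1).
apply: (@runs_if 3) => //; rewrite eE => e.
  apply: runs_assign => //; split=> //=; first by case.
  rewrite /upd /=; move: e; case: (edge x z) => //=; case: (sp z) => //=.
  by rewrite andbF.
apply: runs_skip => //; split=> //; rewrite s10.
by move: e; case: (edge x z) => /=; case: (sp z) => //=; rewrite ?andbT.
Qed.

Let arc_time x y := 20 + edge x y * (100 + n * 65 + pairs_time).
Let arc_ok x y := edge x y ==> [forall z, edge x z ==> (z == y) || separated x y z].
Let some_memory m := exists sp mk, memory m sp mk.

Lemma try_arc_spec s x y (c : bool) :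
  layout (reg s) -> some_memory (Defs.mem s) ->
  node_at (reg s) 4 x -> node_at (reg s) 6 y -> reg s 0 = c ->
  runs try_arc s (arc_time x y) (fun s1 => [/\ agree_pos 8 (reg s) (reg s1),
    some_memory (Defs.mem s1) & reg s1 0 = c && arc_ok x y]).
Proof.
move=> lay [sp [mk M]] nx ny s0.
apply: (@runs_if (10 + edge x y * (100 + n * 65 + pairs_time))).
- by rewrite /arc_time /=; lia.
- rewrite (eval_adj nx ny M) /arc_ok => exy; rewrite (_ : edge x y = true); last first.
    by move: exy; case: (edge x y).
  rewrite mul1n /=.
  apply: (@runs_seq (20 + n * 30) (80 + n * 35 + pairs_time)) => [||]; last by lia.
    apply: (clear_sep_spec lay M _ (Q := fun s1 =>
      memory (Defs.mem s1) (fun=> 0) mk /\ agree 16 (reg s) (reg s1))) => //.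
  move=> s1 [M1 E1].
  have lay1 : layout (reg s1) by apply: agree_layout E1 lay.
  have nx1 : node_at (reg s1) 4 x by apply: agree_node E1 nx.
  have ny1 : node_at (reg s1) 6 y by apply: agree_node E1 ny.
  apply: (@runs_seq 5 (75 + n * 35 + pairs_time)) => [||]; last by lia.
    by apply: runs_write; [|exact: erefl].
  move=> _ <-; rewrite (eval_sep lay1 ny1); set s2 := State _ _.
  have M2 := memory_sep y 1 M1.
  apply: (@runs_seq pairs_time (75 + n * 35)) => [||]; last by lia.
    apply: (try_pairs_spec (s := s2) lay1 M2 nx1 ny1 (Q := fun s3 =>
      exists sp3 mk3, [/\ memory (Defs.mem s3) sp3 mk3, agree 8 (reg s1) (reg s3) &
      forall v, (sp3 v != 0) = (set_at (fun=> 0) y 1 v != 0) || separated x y v])).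
    by move=> s3 sp3 mk3 M3 E3 H3; exists sp3, mk3.
  move=> s3 [sp3 [mk3 [M3 E3 H3]]].
  have lay3 : layout (reg s3) by apply: agree_layout E3 lay1.
  have nx3 : node_at (reg s3) 4 x by apply: agree_node E3 nx1.
  apply: (check_neighbors_spec lay3 M3 nx3 (c := c)) => [||s4 M4 E4 s40].
  + by rewrite E3 // E1.
  + by lia.
  split; last 1 first.
  + rewrite s40; congr (nat_of_bool (_ && _)); apply: eq_forallb => z.
    by rewrite H3 /set_at; case: (z == y).
  + by move=> j /andP[j0 j8]; rewrite E4 ?E3 ?E1 //; lia.
  by exists sp3, mk3.
rewrite (eval_adj nx ny M) /arc_ok => exy; rewrite (_ : edge x y = false); last first.
  by move: exy; case: (edge x y).
by apply: runs_skip => //; split=> //; [exists sp, mk|rewrite s0 andbT].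
Qed.

Let main_time := 100 + n * 41 + (20 + \sum_x (20 + \sum_y (arc_time x y + 20) + 20)).

Lemma init_memory : some_memory (Defs.mem (init G)).
Proof.
(* Whatever lies behind the matrix serves as initial content of the two arrays. *)
exists (fun v => Defs.mem (init G) (base + rank v)).
exists (fun v => Defs.mem (init G) (base + n + rank v)); split=> // u v.
rewrite /row add1n addSn /=.
have H (s : seq G) : u \in s ->
    nth 0 [seq nat_of_bool (edge x y) | x <- s, y <- enum G]
      (index u s * n + rank v) = edge u v.
  elim: s => //= w s IH; rewrite inE nth_cat size_map -cardE -/n eq_sym.
  case: eqVneq => [->|_] /= us.
    by rewrite rank_lt (nth_map v) ?nth_index ?mem_enum // -cardE rank_lt.
  rewrite ifF; last by have := rank_lt v; rewrite -/n mulSn; lia.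
  by rewrite mulSn -addnA addKn IH.
by apply: H; rewrite mem_enum.
Qed.

Lemma recognize_spec : 2 < n ->
  runs recognize (init G) main_time (fun s =>
    output s = (n == 3) || [forall x, forall y, arc_ok x y]).
Proof.
move=> n2.
apply: (@runs_seq 2 (98 + n * 41 +
  (20 + \sum_x (20 + \sum_y (arc_time x y + 20) + 20)))) => [||]; last by rewrite /main_time; lia.
  by apply: runs_assign; [|exact: erefl].
move=> _ <-; apply: (@runs_seq 3 (95 + n * 41 +
  (20 + \sum_x (20 + \sum_y (arc_time x y + 20) + 20)))) => [||]; last by lia.
  by apply: runs_assign; [|exact: erefl].
move=> _ <-; set s1 := State _ _.
have r1 : reg s1 1 = n by [].
have r0 : reg s1 0 = 1 by [].
have M1 : some_memory (Defs.mem s1) by apply: init_memory.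
apply: (@runs_if (80 + n * 41 +
  (20 + \sum_x (20 + \sum_y (arc_time x y + 20) + 20)))) => [|n3|n3]; first by rewrite /=; lia.
  2: apply: runs_skip => //; rewrite /output r0 (_ : n == 3) //.
  2: by have : n - 3 = 0 := n3; lia.
have {}n3 : (n == 3) = false by have : n - 3 != 0 := n3; lia.
apply: (@runs_seq (20 + n * 41) (60 +
  (20 + \sum_x (20 + \sum_y (arc_time x y + 20) + 20)))) => [||]; last by lia.
  apply: (@runs_loop G 4 Skip (fun=> 21) s1 _ (fun p r m => r 0 = 1 /\ some_memory m)
    (fun s => [/\ reg s 1 = n, reg s 5 = base, reg s 0 = 1 & some_memory (Defs.mem s)])) => //.
  + by move=> p r2 r3 m E [E0 Mm]; split=> //; rewrite -E.
  + by move=> p v q s2 _ [I1 I2] *; apply: runs_skip.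
  + by move=> s2 [I1 I2] s21 s25; split.
  by rewrite sum_const_nat.
move=> s2 [s21 s25 s20 M2].
apply: (@runs_seq 2 (58 +
  (20 + \sum_x (20 + \sum_y (arc_time x y + 20) + 20)))) => [||]; last by lia.
  by apply: runs_assign; [|exact: erefl].
move=> _ <-; apply: (@runs_seq 4 (54 +
  (20 + \sum_x (20 + \sum_y (arc_time x y + 20) + 20)))) => [||]; last by lia.
  by apply: runs_assign; [|exact: erefl].
move=> _ <-; set s3 := State _ _.
have lay3 : layout (reg s3) by split; rewrite /s3 /upd /= ?s25 ?s21.
apply: (@runs_and_loop 4 _ (fun x => 20 + \sum_y (arc_time x y + 20)) s3
  (fun x => [forall y, arc_ok x y]) some_memory true) => //; last by lia.
  move=> x s4 d M4 E4 lay4 nx s40.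
  apply: (@runs_and_loop 6 _ (arc_time x) s4 (arc_ok x) some_memory d) => //.
  move=> y s5 e M5 E5 lay5 ny s50.
  have nx5 : node_at (reg s5) 4 x by apply: agree_pos_node E5 nx.
  exact: try_arc_spec.
by move=> s4 _ _; rewrite /output n3 /= => ->.
Qed.

(** * The running time *)

Lemma sum_affine (g : G -> nat) (c d t : nat) :
  \sum_v (c + g v * t + d) = n * (c + d) + (\sum_v g v) * t.
Proof. by rewrite !big_split /= !sum_const_nat -big_distrl /=; lia. Qed.

(** With [A] arcs, n <= A <= 2m. Per arc, at most n + A <= 2A searches of cost [160 * n^2] give
    [320 * A * n^2], and the remaining work raises 320 to 421. Over all arcs this is
    [421 * A^2 * n^2], at most [1684 * n^2 * m^2]; the outer loops fit into the rest of 2100. *)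
Lemma main_time_le : 2 < n -> (forall x, exists y, edge x y) ->
  main_time <= 2100 * (n ^ 2 * #|edges G| ^ 2).
Proof.
move=> n2 deg; pose A := \sum_(x : G) \sum_(y : G) (edge x y : nat).
have Am : A <= 2 * #|edges G|.
  apply: leq_trans (arcs_leq G).
  by rewrite /A pair_big /= -sum1_card [X in _ <= X]big_mkcond /= leq_sum // => p _; case: ifP.
have nA : n <= A.
  rewrite /n -sum1_card; apply: leq_sum => x _.
  by have [y xy] := deg x; rewrite (bigD1 y) //= xy leq_addr.
pose g a := \sum_b ((a == b) || edge a b : nat).
have gA : \sum_a g a <= n + A.
  rewrite -[n]muln1 -sum_const_nat /A -big_split leq_sum //= => a _.
  apply: leq_trans (_ : \sum_b ((a == b) + edge a b) <= _).
    by apply: leq_sum => b _; case: (a == b); case: (edge a b).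
  rewrite big_split leq_add2r (bigD1 a) //= eqxx big1 // => b ba.
  by rewrite eq_sym (negbTE ba).
have rowE a : row_time a = 20 + n * 50 + g a * search_time.
  by rewrite /row_time /pair_time sum_affine addnA.
have pairsE : pairs_time = 20 + (n * (20 + n * 50 + 20) + (\sum_a g a) * search_time).
  by rewrite /pairs_time; congr (_ + _); under eq_bigr => a _ do rewrite rowE; exact: sum_affine.
pose V := 100 + n * 65 + pairs_time.
have mainE : main_time = 120 + n * 41 + (n * (20 + n * 40 + 20) + A * V).
  rewrite /main_time /arc_time -/V.
  under eq_bigr => x _ do rewrite (sum_affine (fun y => edge x y : nat)) addnA.
  by rewrite sum_affine -/A; lia.
have nn : 3 * n <= n * n by rewrite leq_mul2r n2 orbT.
have An : n * n <= A * (n * n) by rewrite leq_pmull //; lia.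
have AAn : A * (n * n) <= A * (A * (n * n)) by rewrite leq_pmull //; lia.
have searchle : search_time <= 160 * (n * n) by rewrite /search_time; lia.
have prodle : (\sum_a g a) * search_time <= 320 * (A * (n * n)).
  apply: leq_trans (leq_mul (_ : _ <= 2 * A) searchle) _; first by lia.
  by lia.
have Vle : V <= 421 * (A * (n * n)) by rewrite /V pairsE; lia.
have AVle : A * V <= 421 * (A * (A * (n * n))).
  by apply: leq_trans (leq_mul (leqnn A) Vle) _; lia.
have mle : A * (A * (n * n)) <= 4 * (n ^ 2 * #|edges G| ^ 2).
  rewrite mulnA; apply: leq_trans (leq_mul (leq_mul Am Am) (leqnn _)) _.
  by rewrite !expnS !expn0 !muln1; lia.
by rewrite mainE; lia.
Qed.

End Specification.

Theorem theorem4p12 :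
  exists (P : prog) (k : nat),
    forall G : sgraph,
      0 < #|G| ->
      two_connected G ->
      (forall a b : G, ~ K2_cutset a b) ->
      exists (s : state) (t : nat),
        [/\ exec P (init G) s t,
            t <= k * (#|G| ^ 2 * #|edges G| ^ 2),
            in_C2 G -> output s = YES
          & ~ in_C2 G -> output s = NO].
Proof.
exists recognize, 2100 => G G0 G2 nK2.
have n2 := two_connected_card G0 G2.
have deg x := two_connected_degree x G0 G2.
have [s [t [ex lt out]]] := recognize_spec n2.
exists s, t; split=> //; first exact: leq_trans lt (main_time_le n2 deg).
  move=> /in_C2P PF; rewrite out (_ : _ || _ = true) //.
  have [//|n3] := eqVneq #|G| 3.
  apply/forallP=> x; apply/forallP=> y; apply/implyP=> xy.
  apply/forallP=> z; apply/implyP=> xz; have [//|zy] := eqVneq z y.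
  have yz : y != z by rewrite eq_sym.
  have [eyz|neyz] := boolP (edge y z); last exact: nonadjacent_separated.
  by case: (triangle_propeller PF nK2 _ xy xz eyz); rewrite ltn_neqAle eq_sym n3.
move=> nC2; rewrite out (_ : _ || _ = false) //; apply/negP=> ok; apply: nC2.
apply/in_C2P; case/orP: ok => [/eqP n3|/forallP ok].
  (* The rim has at least three nodes and the center is a fourth. *)
  move=> c x a b [c3 /andP[_ Uc] _] xc _ _ _ _ _.
  have : uniq (x :: c) by rewrite /= xc.
  by move/card_uniqP => E; have := max_card (mem (x :: c)); rewrite E n3 /= ltnNge c3.
apply: separated_propeller_free => x y z xy xz yz.
have /implyP/(_ xy)/forallP/(_ z) := forallP (ok x) y.
by rewrite xz eq_sym (negbTE yz).
Qed.
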